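(* Let $d\in\mathbb{N}$ and let $T$ be a (necessarily contractive) $d$-parameter $C_0$-semigroup over a Hilbert space $\mathcal{H}$ with bounded generators $A_1,A_2,\ldots,A_d$. If the generators satisfy $$\frac{\|A_i+\omega_i I\|}{\omega_i}\leq 2^{1/d}-1$$ for all $i\in\{1,2,\ldots,d\}$ and some $\boldsymbol{\omega}=(\omega_i)_{i=1}^{d}\in\mathbb{R}_{>0}^{d}$, then $T$ has a regular unitary dilation.
   Context: Hilbert spaces are complex; $\mathfrak{L}(\mathcal{H})$ and $\mathfrak{L}(\mathcal{H},\mathcal{H}')$ denote bounded operators; $I$ is the identity operator; $\mathbb{N}=\{1,2,\ldots\}$. A $d$-parameter $C_0$-semigroup over $\mathcal{H}$ is a map $T:\mathbb{R}_{\geq 0}^{d}\to\mathfrak{L}(\mathcal{H})$, continuous for the strong operator topology (SOT), with $T(\mathbf{0})=I$ and $T(\mathbf{s}+\mathbf{t})=T(\mathbf{s})T(\mathbf{t})$. Its generators $A_1,\ldots,A_d$ are the infinitesimal generators of its marginals, the commuting one-parameter $C_0$-semigroups $T_i(t)=T(t\mathbf{e}_i)$ ($\mathbf{e}_i$ the canonical unit vectors). The parenthetical ''necessarily contractive'' remarks that contractivity ($\|T(\mathbf t)\|\le 1$ for all $\mathbf t$) is not a separate hypothesis. For $\mathbf{t}=(t_i)_{i=1}^d\in\mathbb{R}^d$ put $\mathbf{t}^{+}=(\max\{t_i,0\})_i$ and $\mathbf{t}^{-}=(\max\{-t_i,0\})_i$. A regular unitary dilation of $T$ is a tuple $(U,\mathcal{H}',r)$,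 where $\mathcal{H}'$ is a Hilbert space, $U$ is an SOT-continuous unitary representation of $(\mathbb{R}^d,+,\mathbf{0})$ over $\mathcal{H}'$, and $r\in\mathfrak{L}(\mathcal{H},\mathcal{H}')$ (necessarily isometric), such that $T(\mathbf{t}^{-})^{*}T(\mathbf{t}^{+})=r^{*}U(\mathbf{t})r$ for all $\mathbf{t}\in\mathbb{R}^d$. *)

(* Defs.v *)
From HB Require Import structures.
From mathcomp Require Import all_boot all_order all_algebra.
From mathcomp Require Import all_classical all_reals all_analysis.
From mathcomp Require Import complex ring lra.

Set Implicit Arguments.
Unset Strict Implicit.
Unset Printing Implicit Defensive.

Import Order.TTheory GRing.Theory Num.Theory.
Import numFieldNormedType.Exports.

Local Open Scope classical_set_scope.
Local Open Scope ring_scope.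
Local Open Scope complex_scope.

(* Complex Hilbert spaces; the inner product is linear in its first argument
   and conjugate-linear in its second one. *)
HB.mixin Record CompleteNormedModule_isHilbert (R : realType) (H : Type)
    & CompleteNormedModule R[i] H := {
  inner : {dot H for (@Num.conj R[i])};
  sqr_normE : forall x : H, `|x| ^+ 2 = inner x x
}.

#[short(type="hilbertType")]
HB.structure Definition Hilbert (R : realType) :=
  {H of CompleteNormedModule_isHilbert R H & CompleteNormedModule R[i] H}.

Record bounded_operator (R : realType) (H K : hilbertType R) := BoundedOperator {
  operator_linear :> {linear H -> K};
  operator_bounded : bounded_near operator_linear (nbhs (0 : H))
}.

Section Operators.
Context {R : realType} {H K : hilbertType R}.

(* The norm of a [normedModType R[i]] takes its values in [R[i]], hence the real
   part.  The supremum is 0 when [f] is not bounded on the unit ball. *)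
Definition opnorm (f : H -> K) : R :=
  sup [set complex.Re `|f x| | x in [set x : H | `|x| <= 1]].

(* For [f] a bounded operator the vector [z] exists and is unique, see
   [adjointP] below; otherwise the value may be the default 0. *)
Definition adjoint (f : H -> K) (y : K) : H :=
  xget 0 [set z : H | forall x : H, inner (f x) y = inner x z].

End Operators.

Section InnerProduct.
Context {R : realType} {H : hilbertType R}.
Implicit Types x y z : H.

Lemma innerDl x y z : inner (x + y) z = inner x z + inner y z.
Proof. by rewrite linearDl. Qed.

Lemma innerDr x y z : inner x (y + z) = inner x y + inner x z.
Proof. by rewrite linearDr. Qed.

Lemma innerNr x y : inner x (- y) = - inner x y.
Proof. by rewrite linearNr. Qed.

Lemma innerNl x y : inner (- x) y = - inner x y.
Proof. by rewrite linearNl. Qed.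

Lemma innerZl a x y : inner (a *: x) y = a * inner x y.
Proof. by rewrite linearZl_LR. Qed.

Lemma innerZr a x y : inner x (a *: y) = Num.conj a * inner x y.
Proof. by rewrite linearZr_LR. Qed.

Lemma innerC x y : inner x y = Num.conj (inner y x).
Proof. by rewrite hermC expr0 mul1r. Qed.

Lemma inner_ge0 x : 0 <= inner x x.
Proof. by rewrite -sqr_normE exprn_ge0. Qed.

Lemma inner_CauchySchwarz x y : `|inner x y| <= `|x| * `|y|.
Proof.
have [->|y0] := eqVneq y 0.
  by rewrite -(scale0r (0 : H)) innerZr conjC0 mul0r normr0 mulr_ge0.
have yy : 0 < inner y y by rewrite -sqr_normE exprn_gt0 ?normr_gt0.
rewrite -(@ler_pXn2r _ 2) ?nnegrE ?mulr_ge0// exprMn !sqr_normE.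
have := inner_ge0 (inner y y *: x - inner x y *: y).
rewrite !(innerDl, innerDr, innerNl, innerNr, innerZl, innerZr).
rewrite (innerC y x) normCK (geC0_conj (ltW yy)).
set a := inner x y; set b := inner y y; set c := inner x x => h.
rewrite -subr_ge0 -(pmulr_rge0 _ yy) -/b.
by move: h; apply: eq_ind; congr (0 <= _); ring.
Qed.

End InnerProduct.

Section RieszRepresentation.
Context {R : realType} {H : hilbertType R}.
Implicit Types x y z : H.
Local Notation conj := (@Num.conj R[i]).
Variable phi : H -> R[i].
Hypothesis phiD : forall x y, phi (x + y) = phi x + phi y.
Hypothesis phiZ : forall a x, phi (a *: x) = a * phi x.
Variable c : R.
Hypothesis phiB : forall x, `|phi x| <= c%:C * `|x|.

(* The Riesz representative of [phi] is the minimiser of [F]. *)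
Let G z := inner z z - phi z - conj (phi z).
Let F z := complex.Re (G z).

Let innerC_real z : inner z z \is Num.real. Proof. exact/ger0_real/inner_ge0. Qed.

Let GF z : G z = (F z)%:C.
Proof.
rewrite /F RRe_real// /G -addrA -opprD; apply: rpredB; first exact: innerC_real.
by rewrite CrealE rmorphD/= conjCK addrC.
Qed.

Let F_lb z : - c ^+ 2 <= F z.
Proof.
rewrite -lecR -GF rmorphN rmorphXn /= /G -sqr_normE.
have h1 : phi z + conj (phi z) <= 2 * (c%:C * `|z|).
  have r : phi z + conj (phi z) \is Num.real by rewrite CrealE rmorphD/= conjCK addrC.
  apply: le_trans (real_ler_norm r) _; apply: le_trans (ler_normD _ _) _.
  by rewrite norm_conjC mulr_natl mulr2n lerD.
rewrite -addrA -opprD -subr_ge0.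
have : 0 <= (`|z| - c%:C) ^+ 2 + (2 * (c%:C * `|z|) - (phi z + conj (phi z))).
  apply: addr_ge0; last by rewrite subr_ge0.
  by rewrite -realEsqr rpredB// ?normr_real// complex_real.
by apply: eq_ind; congr (0 <= _); ring.
Qed.

Let m := inf (range F).
Let has_infF : has_inf (range F).
Proof. by split; [exists (F 0), 0|exists (- c ^+ 2) => _ [z _ <-]; exact: F_lb]. Qed.
Let mF z : m <= F z.
Proof. by apply: ge_inf; [exact: (proj2 has_infF)|exists z]. Qed.

Let F_ex e : 0 < e -> exists z, F z <= m + e.
Proof.
move=> e0; have [_ [z _ <-] /ltW ?] := inf_adherent e0 has_infF.
by exists z.
Qed.

Let F_close e z w : F z <= m + e -> F w <= m + e -> `|z - w| ^+ 2 <= (4 * e)%:C.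
Proof.
move=> zm wm.
have h : 2 * F z + 2 * F w - 4 * F (2^-1 *: (z + w)) <= 4 * e.
  by have := mF (2^-1 *: (z + w)); lra.
rewrite -lecR in h; apply: le_trans h.
rewrite rmorphB rmorphD !rmorphM /= !rmorph_nat -!GF sqr_normE /G.
rewrite phiZ phiD !(innerDl, innerDr, innerNl, innerNr, innerZl, innerZr).
rewrite rmorphM rmorphD fmorphV rmorph_nat.
rewrite le_eqVlt; apply/orP; left; apply/eqP; field.
  by [].
Qed.

Let F_var e z x : F z <= m + e ->
  `|inner x z - phi x| ^+ 2 <= e%:C * (`|x| ^+ 2 + 1).
Proof.
move=> zm; set a := inner x z - phi x.
have x1 : 0 < `|x| ^+ 2 + 1 by rewrite ltr_wpDl// exprn_ge0.
pose t := (`|x| ^+ 2 + 1)^-1.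
have t0 : 0 < t by rewrite invr_gt0.
have tr : conj t = t by rewrite geC0_conj// ltW.
have h : F z - F (z - (t * conj a) *: x) <= e.
  by have := mF (z - (t * conj a) *: x); lra.
rewrite -lecR rmorphB /= -!GF /G in h.
rewrite -ler_pdivrMr// -/t; apply: le_trans h.
rewrite -scaleNr phiD phiZ !(innerDl, innerDr, innerZl, innerZr).
rewrite !(rmorphM, rmorphD, rmorphN, conjCK) /= tr (innerC z x) conjCK.
rewrite -sqr_normE -[inner x x]sqr_normE normCK.
have -> : `|x| ^+ 2 = t^-1 - 1 by rewrite invrK addrK.
rewrite -subr_ge0.
have : 0 <= t ^+ 2 * (a * conj a) by rewrite mulr_ge0 ?mul_conjC_ge0 ?exprn_ge0 ?ltW.
apply: eq_ind; congr (0 <= _); rewrite /a rmorphB/=.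
by rewrite !conjCK; field; rewrite gt_eqF.
Qed.

Lemma riesz_ex : exists z, forall x, phi x = inner x z.
Proof.
pose Fil := filter_from [set e : R | 0 < e] (fun e => [set z | F z <= m + e]).
have FF : ProperFilter Fil.
  apply: filter_from_proper; last by move=> e /F_ex.
  apply: filter_from_filter; first by exists 1 => /=.
  move=> i j /= i0 j0; exists (Num.min i j); first by rewrite /= lt_min i0.
  move=> z /= zm; split; apply: (le_trans zm); rewrite lerD2l ge_min lexx ?orbT//.
have /cvg_ex [z zF] : cvg Fil.
  apply: (@cauchy_cvg H); apply/cauchy_ballP => eps eps0.
  have epsr : eps = (complex.Re eps)%:C by rewrite RRe_real// gtr0_real.
  have e0 : 0 < complex.Re eps by rewrite -ltcR -epsr.
  exists (([set z | F z <= m + complex.Re eps ^+ 2 / 8]),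
          ([set z | F z <= m + complex.Re eps ^+ 2 / 8])) => /=.
    by split; exists (complex.Re eps ^+ 2 / 8) => //=; rewrite divr_gt0 ?exprn_gt0.
  move=> [u v] [/= um vm]; rewrite -ball_normE /=.
  rewrite -(@ltr_pXn2r _ 2) ?nnegrE ?(ltW eps0)//.
  apply: le_lt_trans (F_close um vm) _.
  rewrite [X in _ < X ^+ 2]epsr -rmorphXn ltcR.
  by move: (exprn_gt0 2 e0); lra.
exists z => x; apply/eqP; rewrite -subr_eq0 -normr_eq0 -normrN opprB.
rewrite eq_le normr_ge0 andbT; apply/ler_addgt0Pr => eps eps0.
rewrite add0r.
have epsr : eps = (complex.Re eps)%:C by rewrite RRe_real// gtr0_real.
have e0 : 0 < complex.Re eps by rewrite -ltcR -epsr.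
pose b := complex.Re `|x|.
have xr : `|x| = b%:C by rewrite RRe_real// normr_real.
have b0 : 0 <= b by rewrite -lecR -xr normr_ge0.
pose d := complex.Re eps / 2 / (b + 1).
have d0 : 0 < d by rewrite !divr_gt0// ltr_wpDl.
pose k := (complex.Re eps / 2) ^+ 2 / (b ^+ 2 + 1).
have b1 : 0 < b ^+ 2 + 1 by rewrite ltr_wpDl// exprn_ge0.
have k0 : 0 < k by rewrite divr_gt0// exprn_gt0// divr_gt0.
have n1 : Fil (ball z d%:C) by apply: zF; apply: nbhsx_ballx; rewrite ltcR.
have n2 : Fil [set w | F w <= m + k] by exists k.
have [w [/= wz wm]] := filter_ex (filterI n1 n2).
rewrite -ball_normE /= in wz.
have -> : inner x z - phi x = inner x (z - w) + (inner x w - phi x).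
  by rewrite innerDr innerNr addrA subrK.
apply: le_trans (ler_normD _ _) _.
have -> : eps = (complex.Re eps / 2)%:C + (complex.Re eps / 2)%:C.
  by rewrite -rmorphD /= {1}epsr; congr (_%:C); field.
apply: lerD.
  apply: le_trans (inner_CauchySchwarz _ _) _.
  apply: (@le_trans _ _ (b%:C * d%:C)); first by rewrite xr ler_wpM2l ?lecR// ltW.
  rewrite -rmorphM lecR /d mulrA mulrC ler_pdivrMl ?ltr_wpDl//.
  by nra.
rewrite -(@ler_pXn2r _ 2) ?nnegrE ?normr_ge0//; last first.
  by rewrite lecR ltW// divr_gt0.
apply: le_trans (F_var _ wm) _.
rewrite xr -!rmorphXn -(rmorph1 (real_complex R)) -rmorphD -rmorphM lecR /k.
by rewrite divfK // gt_eqF.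
Qed.

End RieszRepresentation.

Section Adjoint.
Context {R : realType} {H K : hilbertType R}.

Lemma bounded_operatorP (f : bounded_operator H K) :
  exists c : R, forall x, `|f x| <= c%:C * `|x|.
Proof.
have /linear_boundedP/pinfty_ex_gt0[c c0 fc] := operator_bounded f.
by exists (complex.Re c) => x; rewrite RRe_real// gtr0_real.
Qed.

Lemma adjointP (f : bounded_operator H K) x y :
  inner (f x) y = inner x (adjoint f y).
Proof.
have [c fc] := bounded_operatorP f.
rewrite /adjoint; case: xgetP => [z _ ->//|/= none].
have [] := @riesz_ex R H (fun x => inner (f x) y) _ _ (c * complex.Re `|y|) _.
- by move=> u v; rewrite linearD innerDl.
- by move=> a u; rewrite linearZ innerZl.
- move=> u; apply: le_trans (inner_CauchySchwarz _ _) _.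
  rewrite rmorphM /= RRe_real ?normr_real// mulrAC.
  by rewrite ler_wpM2r.
- by move=> z zP; case: (none z) => u; exact: zP.
Qed.

End Adjoint.

Definition unitary (R : realType) (H : hilbertType R)
    (U : bounded_operator H H) : Prop :=
  (forall x, adjoint U (U x) = x) /\ (forall x, U (adjoint U x) = x).

Section Semigroups.
Context {R : realType} {d : nat}.

Definition orthant : set 'rV[R]_d := [set t | forall i, 0 <= t 0 i].

Definition pos_part (t : 'rV[R]_d) : 'rV[R]_d := \row_i Num.max (t 0 i) 0.
Definition neg_part (t : 'rV[R]_d) : 'rV[R]_d := \row_i Num.max (- t 0 i) 0.

Context {H : hilbertType R}.

(* A map on the orthant is encoded as a map on all of ['rV[R]_d] whose values
   off the orthant are arbitrary and never used. *)
Record C0_semigroup (T : 'rV[R]_d -> bounded_operator H H) : Prop := {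
  semigroup0 : T 0 =1 id;
  semigroupD : forall s t, orthant s -> orthant t ->
    T (s + t) =1 T s \o T t;
  semigroup_continuous : forall x, {within orthant, continuous (T ^~ x)}
}.

Definition marginal (T : 'rV[R]_d -> bounded_operator H H) (i : 'I_d) (t : R) :
  bounded_operator H H := T (t *: delta_mx 0 i).

(* The graph of the (in general unbounded) infinitesimal generator. *)
Definition generator (S : R -> bounded_operator H H) : set (H * H) :=
  [set xy | (t^-1)%:C *: (S t xy.1 - xy.1) @[t --> 0^'+] --> xy.2].

Definition has_bounded_generator (S : R -> bounded_operator H H)
    (A : bounded_operator H H) : Prop :=
  generator S = [set (x, A x) | x in setT].

Record unitary_representation (U : 'rV[R]_d -> bounded_operator H H) : Prop := {
  representation_unitary : forall t, unitary (U t);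
  representation0 : U 0 =1 id;
  representationD : forall s t, U (s + t) =1 U s \o U t;
  representation_continuous : forall x, continuous (U ^~ x)
}.

End Semigroups.

Definition regular_unitary_dilation (R : realType) (d : nat)
    (H K : hilbertType R) (T : 'rV[R]_d -> bounded_operator H H)
    (U : 'rV[R]_d -> bounded_operator K K) (r : bounded_operator H K) : Prop :=
  unitary_representation U /\
  forall t : 'rV[R]_d,
    adjoint (T (neg_part t)) \o T (pos_part t) =1 adjoint r \o U t \o r.

(* Main.v *)
Require Import Defs.
From HB Require Import structures.
From mathcomp Require Import all_boot all_order all_algebra.
From mathcomp Require Import all_classical all_reals all_analysis.
From mathcomp Require Import complex ring lra.

(** The operators T(t^-)^* T(t^+) are compressions of a unitary representation as
    soon as they form a positive definite function of t: a Hilbert space carrying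
    the representation is then reconstructed from the values of this function.  So
    with the forms phi t u v = <T(t^+) u, T(t^-) v> two things have to be shown.

    Positive definiteness.  It is obtained one coordinate at a time, for kernels
    kappa whose entries are bounded sesquilinear forms on H.  Let S be one of the
    marginal semigroups, A its generator, and let t_a be the coordinates of the
    points in this direction.  With m = min(t_a, t_b, tau), the sum over a, b of
    kappa_ab (S(t_a - m) xi_a, S(t_b - m) xi_b) is a value of the quadratic form of
    kappa when tau is small, and that of the kernel in which S((t_a - t_b)^+) and
    S((t_b - t_a)^+) have been inserted when tau is large.  Its derivative in tau is
    a value of the quadratic form of D kappa, where
    D beta (u, v) = - beta (A u, v) - beta (u, A v).  Hence if kappa and D kappa are
    positive definite, so is the new kernel [positive_definite_propagate].
    Starting from the constant kernel <u, v> and passing through all coordinates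
    [positive_definite_regular], what is needed is that D_i D_j ... D_k <.,.> is a
    nonnegative form for distinct i, j, ..., k: the generators are completely
    dissipative.

    This is where the norm bound enters.  Write A_i = omega_i (C_i - I), so that
    |C_i| <= c with (1 + c)^d = 2.  Then D_i beta (u, v) equals
    omega_i (2 beta (u, v) - beta (C_i u, v) - beta (u, C_i v)); after division by
    2 omega_i each application of D_i perturbs its argument by a relative error at
    most c, and n applications to <u, v> by at most (1 + c)^n - 1 <= 1
    [dissipations_near_inner].

    Dilation.  Put k ((s, u), (t, v)) = phi (s - t) u v, a scalar positive kernel on
    the set X of pairs (t, u).  The space of the dilation is the reproducing kernel
    Hilbert space of k, whose elements are functions on X; translations of the
    first component preserve k, so that composition with them is a unitary
    representation, and r u is the function k ((0, u), _) [naimark_dilation].  The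
    space is described as the set of the functions that define a bounded functional
    on finite combinations of points, so that limits of elements are elements.  The
    inner product is obtained by approximating such functionals by combinations. *)

Set Implicit Arguments.
Unset Strict Implicit.
Unset Printing Implicit Defensive.

Import Order.TTheory GRing.Theory Num.Theory.
Import numFieldNormedType.Exports.

Local Open Scope classical_set_scope.
Local Open Scope ring_scope.
Local Open Scope complex_scope.

Local Notation "z ^*" := (Num.conj z) : complex_scope.

(** * Estimates in the complex numbers *)

Lemma le_of_le_small (C : numFieldType) (x y K : C) : 0 <= K ->
  (forall e, 0 < e -> e <= 1 -> x <= y + K * e) -> x <= y.
Proof.
move=> K0 h; apply/ler_addgt0Pr => eta eta0.
have d0 : 0 < K + 1 + eta by rewrite ltr_wpDl// addr_ge0.
apply: (le_trans (h (eta / (K + 1 + eta)) _ _)).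
- by rewrite divr_gt0.
- by rewrite ler_pdivrMr// mul1r lerDr addr_ge0.
rewrite lerD2l mulrCA ger_pMr// ler_pdivrMr// mul1r -addrA lerDl addr_ge0//.
exact: ltW.
Qed.

Lemma eq0_small (C : numFieldType) (x K : C) : 0 <= K ->
  (forall e, 0 < e -> e <= 1 -> `|x| <= K * e) -> x = 0.
Proof.
move=> K0 h; apply/eqP; rewrite -normr_le0.
by apply: (le_of_le_small K0) => e e0 e1; rewrite add0r h.
Qed.

(** The Cauchy-Schwarz inequality for a semidefinite hermitian form, expressed by
    the three numbers a = <x, x>, b = <x, y>, c = <y, y> so that it applies both to
    formal combinations, which do not form a vector space, and to vectors. *)
Lemma quadratic_CauchySchwarz (C : numClosedFieldType) (a b c : C) :
    (forall s t, 0 <= s * s^* * a + s * t^* * b + (s * t^* * b)^*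
                      + t * t^* * c) ->
  0 <= a -> 0 <= c -> `|b| <= sqrtC a * sqrtC c.
Proof.
move=> h a0 c0.
rewrite -(@ler_pXn2r _ 2) ?nnegrE ?mulr_ge0 ?sqrtC_ge0// exprMn !sqrtCK normCK.
have bb : 0 <= b * b^* by rewrite mul_conjC_ge0.
move: c0; rewrite le_eqVlt => /predU1P[c0|c0].
  have [->|b0] := eqVneq b 0; first by rewrite mul0r mulr_ge0// -c0.
  (* For c = 0 and b != 0 the quadratic expression is affine in t and takes
     negative values far enough in the direction of - b. *)
  have b1 : b * b^* != 0 by rewrite mulf_neq0// fmorph_eq0.
  have [q qr qb] : exists2 q, q^* = q & q * (b * b^*) = a + 1.
    exists ((a + 1) / (b * b^*)); last by rewrite divfK.
    by rewrite geC0_conj// divr_ge0// addr_ge0.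
  have := h 1 (- q * b).
  rewrite -c0 !(rmorphM, rmorphN, conjCK, rmorph1) /= !conjCK.
  rewrite qr !mul1r mulr0 addr0.
  rewrite !mulNr -!mulrA [b^* * b]mulrC qb.
  have -> : a - (a + 1) - (a + 1) = - (a + 2) by ring.
  by rewrite oppr_ge0 => a2; have := lt_le_trans (ltr_wpDl a0 (ltr0Sn C 1)) a2; rewrite ltxx.
rewrite -subr_ge0 -(pmulr_rge0 _ c0).
have := h c (- b); apply: eq_ind; congr (0 <= _).
rewrite !(rmorphM, rmorphN) /= conjCK (geC0_conj (ltW c0)); ring.
Qed.

Section ComplexNumbers.
Context {R : realType}.
Implicit Types a b c s t z : R[i].

Lemma real_interval_point (I : Type) (D : set I) (l u : I -> R) :
    (forall i j, D i -> D j -> l i <= u j) ->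
  exists x, forall i, D i -> l i <= x <= u i.
Proof.
move=> lu; have [[i0 Di0]|D0] := pselect (exists i, D i); last first.
  by exists 0 => i Di; case: D0; exists i.
exists (sup [set l i | i in D]) => i Di; apply/andP; split.
  by apply: ub_le_sup; [exists (u i) => _ [j Dj <-]; exact: lu|exists i].
by apply: ge_sup; [exists (l i0), i0|move=> _ [j Dj <-]; exact: lu].
Qed.

Lemma normc_le_ReIm z (r : R) :
  `|complex.Re z| <= r -> `|complex.Im z| <= r -> `|z| <= 2 * r%:C.
Proof.
move=> hr hi; rewrite [z]complexE; apply: le_trans (ler_normD _ _) _.
rewrite normrM mulr_natl mulr2n lerD//.
  by rewrite (_ : `| _%:C| = `|complex.Re z|%:C) ?lecR// !normc_def /= expr0n addr0 sqrtr_sqr.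
rewrite (_ : `|'i%C : R[i]| = 1) ?mul1r; last first.
  by rewrite normc_def /= expr0n expr1n add0r sqrtr1.
by rewrite (_ : `| _%:C| = `|complex.Im z|%:C) ?lecR// !normc_def /= expr0n addr0 sqrtr_sqr.
Qed.

Lemma ReD z t : complex.Re (z + t) = complex.Re z + complex.Re t.
Proof. by case: z t => [? ?] [? ?]. Qed.

Lemma ReN z : complex.Re (- z) = - complex.Re z.
Proof. by case: z. Qed.

Lemma ReB z t : complex.Re (z - t) = complex.Re z - complex.Re t.
Proof. by rewrite ReD ReN. Qed.

Lemma ImB z t : complex.Im (z - t) = complex.Im z - complex.Im t.
Proof. by case: z t => [? ?] [? ?]. Qed.

Lemma normc_ge_Im z : `|complex.Im z|%:C <= `|z|.
Proof.
case: z => x y; have := normc_ge_Re (y +i* x).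
by rewrite !normc_def /= addrC.
Qed.

(** Discs that meet pairwise have an approximate common point, because their
    projections to the two axes are families of pairwise intersecting intervals.
    The factor 2 is harmless when discs of arbitrarily small radius are among them,
    and the point is then the limit of their centres. *)
Lemma disc_point (I : Type) (D : set I) (a r : I -> R[i]) :
    (forall i j, D i -> D j -> `|a i - a j| <= r i + r j) ->
  exists z, forall i, D i -> `|z - a i| <= 2 * r i.
Proof.
move=> h.
have rr i : D i -> r i = (complex.Re (r i))%:C.
  move=> Di; rewrite RRe_real// ger0_real//.
  by have := h _ _ Di Di; rewrite subrr normr0 -mulr2n pmulrn_lge0.
have rij i j : D i -> D j -> `|a i - a j| <= (complex.Re (r i) + complex.Re (r j))%:C.
  by move=> Di Dj; rewrite rmorphD /= -rr// -rr//; exact: h.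
have [i j Di Dj|x xP] := @real_interval_point I D
    (fun i => complex.Re (a i) - complex.Re (r i))
    (fun i => complex.Re (a i) + complex.Re (r i)).
  move: (le_trans (normc_ge_Re _) (rij i j Di Dj)).
  by rewrite lecR ReB ler_norml => /andP[? ?]; lra.
have [i j Di Dj|y yP] := @real_interval_point I D
    (fun i => complex.Im (a i) - complex.Re (r i))
    (fun i => complex.Im (a i) + complex.Re (r i)).
  move: (le_trans (normc_ge_Im _) (rij i j Di Dj)).
  by rewrite lecR ImB ler_norml => /andP[? ?]; lra.
exists (x +i* y) => i Di; rewrite (rr i Di).
by apply: normc_le_ReIm; rewrite (ReB, ImB) /= ler_norml;
  [move: (xP i Di)|move: (yP i Di)] => /andP[? ?]; apply/andP; split; lra.
Qed.

End ComplexNumbers.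

(** * Formal combinations of the points of a positive kernel *)

(** The list of the pairs (a_j, x_j) stands for the combination of the points x_j
    with coefficients a_j, and [gram] for the inner product of two combinations. *)
Definition gram (R : realType) (X : Type) (k : X -> X -> R[i])
    (v w : seq (R[i] * X)) : R[i] :=
  \sum_(p <- v) \sum_(q <- w) p.1 * q.1^* * k p.2 q.2.

Record positive_kernel (R : realType) (X : Type) := PositiveKernel {
  kernel_fun :> X -> X -> R[i];
  kernel_herm : forall x y, kernel_fun x y = (kernel_fun y x)^*;
  kernel_ge0 : forall w, 0 <= gram kernel_fun w w
}.

Section Combinations.
Context {R : realType} {X : Type} (k : positive_kernel R X).
Implicit Types (a : R[i]) (f g : X -> R[i]) (u v w : seq (R[i] * X)).

(** For f in the Hilbert space under construction, the inner product of f with the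
    combination w. *)
Definition pairing f w : R[i] := \sum_(p <- w) p.1^* * f p.2.
Definition kernel_section v : X -> R[i] := fun y => \sum_(p <- v) p.1 * k p.2 y.
Definition scale a w : seq (R[i] * X) := [seq (a * p.1, p.2) | p <- w].
Definition gram_norm w : R[i] := sqrtC (gram k w w).

Lemma pairing_cat f v w : pairing f (v ++ w) = pairing f v + pairing f w.
Proof. exact: big_cat. Qed.

Lemma pairing_scale f a w : pairing f (scale a w) = a^* * pairing f w.
Proof.
rewrite /pairing big_map mulr_sumr; apply: eq_bigr => p _ /=.
by rewrite rmorphM /= mulrA.
Qed.

Lemma pairing1 f x : pairing f [:: (1, x)] = f x.
Proof. by rewrite /pairing big_seq1 /= rmorph1 mul1r. Qed.

Lemma pairingD f g w : pairing (f + g) w = pairing f w + pairing g w.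
Proof. by rewrite -big_split; apply: eq_bigr => p _ /=; rewrite -mulrDr. Qed.

Lemma pairingZ a f w : pairing (a *: f) w = a * pairing f w.
Proof. by rewrite mulr_sumr; apply: eq_bigr => p _; rewrite mulrCA. Qed.

Lemma pairingB f g w : pairing (f - g) w = pairing f w - pairing g w.
Proof. by rewrite -scaleN1r pairingD pairingZ mulN1r. Qed.

Lemma pairing_section v w : pairing (kernel_section v) w = gram k v w.
Proof.
rewrite /gram exchange_big; apply: eq_bigr => q _ /=.
by rewrite mulr_sumr; apply: eq_bigr => p _; ring.
Qed.

Lemma gramC v w : gram k v w = (gram k w v)^*.
Proof.
rewrite rmorph_sum /= /gram exchange_big; apply: eq_bigr => q _ /=.
rewrite rmorph_sum; apply: eq_bigr => p _ /=.
by rewrite !rmorphM /= conjCK -kernel_herm; congr (_ * _); ring.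
Qed.

Lemma gram_catr u v w : gram k u (v ++ w) = gram k u v + gram k u w.
Proof. by rewrite -!pairing_section pairing_cat. Qed.

Lemma gram_catl u v w : gram k (v ++ w) u = gram k v u + gram k w u.
Proof. exact: big_cat. Qed.

Lemma gram_scaler a v w : gram k v (scale a w) = a^* * gram k v w.
Proof. by rewrite -!pairing_section pairing_scale. Qed.

Lemma gram_scalel a v w : gram k (scale a v) w = a * gram k v w.
Proof. by rewrite gramC gram_scaler rmorphM /= conjCK -gramC. Qed.

Definition gramE := (gram_catr, gram_catl, gram_scaler, gram_scalel).

Lemma gram_norm_ge0 w : 0 <= gram_norm w.
Proof. by rewrite sqrtC_ge0 kernel_ge0. Qed.

Lemma gram_normK w : gram_norm w ^+ 2 = gram k w w.
Proof. exact: sqrtCK. Qed.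

Lemma gram_CauchySchwarz v w : `|gram k v w| <= gram_norm v * gram_norm w.
Proof.
apply: quadratic_CauchySchwarz; rewrite ?kernel_ge0// => s t.
have := kernel_ge0 k (scale s v ++ scale t w).
apply: eq_ind; congr (0 <= _); rewrite !gramE.
rewrite !rmorphM /= conjCK -gramC; ring.
Qed.

End Combinations.
Arguments gram_norm {R X} k w.

Section Domination.
Context {R : realType} {X : Type} (k : positive_kernel R X).
Implicit Types (a b c e : R[i]) (f g h : X -> R[i]) (u v w z : seq (R[i] * X)).
Local Notation section := (kernel_section k).
Local Notation gram_norm := (gram_norm k).

(** The norm of f, as a functional on combinations, is at most c. *)
Definition dominated f c := 0 <= c /\ forall w, `|pairing f w| <= c * gram_norm w.

(** The inner product of f and g is the limit of [pairing f z] when the combination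
    z approaches g; the quantitative form makes the limit compatible with the
    algebraic operations. *)
Definition has_inner f g a :=
  exists c, 0 <= c /\
    forall e z, dominated (g - section z) e -> `|a - pairing f z| <= c * e.

Lemma dominated_le f c e : c <= e -> dominated f c -> dominated f e.
Proof.
move=> ce [c0 fc]; split=> [|w]; first exact: le_trans ce.
by apply: le_trans (fc w) _; rewrite ler_wpM2r ?gram_norm_ge0.
Qed.

Lemma dominatedD f g c e : dominated f c -> dominated g e -> dominated (f + g) (c + e).
Proof.
move=> [c0 fc] [e0 ge]; split=> [|w]; first exact: addr_ge0.
by rewrite pairingD mulrDl; apply: le_trans (ler_normD _ _) _; exact: lerD.
Qed.

Lemma dominatedZ a f c : dominated f c -> dominated (a *: f) (`|a| * c).
Proof.
move=> [c0 fc]; split=> [|w]; first exact: mulr_ge0.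
by rewrite pairingZ normrM -mulrA ler_wpM2l.
Qed.

Lemma dominatedN f c : dominated f c -> dominated (- f) c.
Proof. by move=> /(dominatedZ (- 1)); rewrite scaleN1r normrN1 mul1r. Qed.

Lemma dominatedB f g c e : dominated f c -> dominated g e -> dominated (f - g) (c + e).
Proof. by move=> fc /dominatedN; exact: dominatedD. Qed.

Lemma dominatedB_sym f g c : dominated (f - g) c -> dominated (g - f) c.
Proof. by move/dominatedN; rewrite opprB. Qed.

Lemma dominatedB_trans f g h c e :
  dominated (f - g) c -> dominated (g - h) e -> dominated (f - h) (c + e).
Proof. by move=> fg gh; have := dominatedD fg gh; rewrite addrA subrK. Qed.

Lemma dominated_section v : dominated (section v) (gram_norm v).
Proof.
by split=> [|w]; rewrite ?gram_norm_ge0// pairing_section gram_CauchySchwarz.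
Qed.

Lemma gram_norm_le v c : dominated (section v) c -> gram_norm v <= c.
Proof.
move=> [c0 /(_ v)]; rewrite pairing_section -gram_normK normrX expr2.
rewrite ger0_norm ?gram_norm_ge0//.
have := gram_norm_ge0 k v; rewrite le_eqVlt => /predU1P[<-//|v0].
by rewrite ler_pM2r.
Qed.

Lemma sectionB v w : section (v ++ scale (- 1) w) = section v - section w.
Proof.
apply/funext => y; rewrite -[RHS]/(section v y - section w y) /kernel_section.
rewrite big_cat /scale big_map /= -sumrN.
by congr (_ + _); apply: eq_bigr => p _; rewrite mulN1r mulNr.
Qed.

Lemma pairing_near f c z z' g e e' : dominated f c ->
    dominated (g - section z) e -> dominated (g - section z') e' ->
  `|pairing f z - pairing f z'| <= c * (e + e').
Proof.
move=> [c0 fc] gz gz'.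
have zz' : dominated (section z - section z') (e + e').
  exact: dominatedB_trans (dominatedB_sym gz) gz'.
have -> : pairing f z - pairing f z' = pairing f (z ++ scale (- 1) z').
  by rewrite pairing_cat pairing_scale rmorphN rmorph1 mulN1r.
by apply: le_trans (fc _) _; rewrite ler_wpM2l// gram_norm_le// sectionB.
Qed.

(** Combinations are dense.  As in the proof of the Riesz representation theorem,
    z is an almost minimiser of |z - f|^2 - |f|^2 = <z, z> - 2 Re <f, z>, which is
    bounded below by - c^2: displacing z along w cannot improve the value by more
    than e^2, which bounds the component of f - z along w. *)
Lemma section_approximation f c e : dominated f c -> 0 < e ->
  exists z, dominated (f - section z) e.
Proof.
move=> [c0 fc] e0.
pose G z := gram k z z - (pairing f z + (pairing f z)^*).
have sumr z : pairing f z + (pairing f z)^* \is Num.real.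
  by rewrite CrealE rmorphD/= conjCK addrC.
have Gr z : G z = (complex.Re (G z))%:C.
  by rewrite RRe_real// rpredB// ger0_real// kernel_ge0.
have Glb z : - c ^+ 2 <= G z.
  rewrite /G -gram_normK -subr_ge0.
  have h : pairing f z + (pairing f z)^* <= 2 * (c * gram_norm z).
    apply: le_trans (real_ler_norm (sumr z)) _; apply: le_trans (ler_normD _ _) _.
    by rewrite norm_conjC mulr_natl mulr2n lerD.
  have : 0 <= (gram_norm z - c) ^+ 2
      + (2 * (c * gram_norm z) - (pairing f z + (pairing f z)^*)).
    apply: addr_ge0; last by rewrite subr_ge0.
    by rewrite -realEsqr rpredB// ger0_real// gram_norm_ge0.
  by apply: eq_ind; congr (0 <= _); ring.
have cr : c = (complex.Re c)%:C by rewrite RRe_real// ger0_real.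
have er : e = (complex.Re e)%:C by rewrite RRe_real// gtr0_real.
have hinf : has_inf (range (fun z => complex.Re (G z))).
  split; first by exists (complex.Re (G [::])), [::].
  exists (- complex.Re c ^+ 2) => _ [z _ <-].
  by rewrite -lecR -Gr rmorphN rmorphXn /= -cr.
have ee0 : 0 < complex.Re e ^+ 2 by rewrite exprn_gt0// -ltcR -er.
have [_ [z _ <-] zm] := inf_adherent ee0 hinf.
exists z; split=> [|w]; first exact: ltW.
rewrite pairingB pairing_section; set b := _ - _.
have key t : 0 <= t -> 2 * t * (b * b^*) <= e ^+ 2 + t ^+ 2 * (b * b^*) * gram k w w.
  move=> t0; pose z' := z ++ scale (t * b) w.
  have : complex.Re (G z) <= complex.Re (G z') + complex.Re e ^+ 2.
    apply: le_trans (ltW zm) _; rewrite lerD2r; apply: ge_inf; last by exists z'.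
    by case: hinf.
  rewrite -lecR rmorphD rmorphXn /= -!Gr -er => h.
  rewrite -subr_ge0; move: h; rewrite -[X in is_true X -> _]subr_ge0.
  apply: eq_ind; congr (0 <= _).
  rewrite /G /z' !gramE !pairing_cat !pairing_scale.
  rewrite !(rmorphD, rmorphM) /= !conjCK (geC0_conj t0) /b rmorphN /=.
  rewrite (gramC k w z); ring.
rewrite -(@ler_pXn2r _ 2) ?nnegrE ?mulr_ge0 ?gram_norm_ge0 ?(ltW e0)//.
rewrite exprMn gram_normK normCK.
(* The optimal displacement is t = 1 / <w, w>; when <w, w> = 0 any large t shows
   that the component vanishes. *)
have := kernel_ge0 k w; rewrite le_eqVlt => /predU1P[q0|q0].
  rewrite -q0 mulr0.
  have bb : 0 <= b * b^* by rewrite mul_conjC_ge0.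
  move: bb; rewrite le_eqVlt => /predU1P[<-//|bb].
  have := key (e ^+ 2 / (b * b^*)).
  rewrite -q0 mulr0 addr0 -mulrA divfK ?gt_eqF// => /(_ (ltW (divr_gt0 _ bb))).
  rewrite exprn_gt0// => /(_ isT).
  by rewrite mulr_natl mulr2n gerDl => /(lt_le_trans (exprn_gt0 2 e0)); rewrite ltxx.
have := key (gram k w w)^-1; rewrite invr_ge0 (ltW q0) => /(_ isT).
rewrite -(ler_pM2r q0).
set q := gram k w w; set N := b * b^*; rewrite -/q in q0.
have -> : 2 * q^-1 * N * q = N + N by field; rewrite gt_eqF.
have -> : (e ^+ 2 + q^-1 ^+ 2 * N * q) * q = e ^+ 2 * q + N by field; rewrite gt_eqF.
by rewrite lerD2r.
Qed.

End Domination.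

(** * The reproducing kernel Hilbert space *)

Section InnerRelation.
Context {R : realType} {X : Type} (k : positive_kernel R X).
Implicit Types (a b c e : R[i]) (f g h : X -> R[i]) (u v w z : seq (R[i] * X)).
Local Notation section := (kernel_section k).
Local Notation gram_norm := (gram_norm k).
Local Notation dominated := (dominated k).
Local Notation has_inner := (has_inner k).

Lemma has_inner_ex f g c b : dominated f c -> dominated g b -> exists a, has_inner f g a.
Proof.
move=> fc gb; have [c0 _] := fc.
have [ez ez' D D'|a aP] := @disc_point R _ [set ez : R[i] * seq (R[i] * X) |
    dominated (g - section ez.2) ez.1] (fun ez => pairing f ez.2) (fun ez => c * ez.1).
  by rewrite -mulrDr; exact: pairing_near D D'.
exists a, (2 * c); split=> [|e z gz]; first by rewrite mulr_ge0.
by rewrite -mulrA; exact: (aP (e, z)).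
Qed.

Lemma has_inner_uniq f g b a a' : dominated g b ->
  has_inner f g a -> has_inner f g a' -> a = a'.
Proof.
move=> gb [c [c0 ac]] [c' [c'0 ac']]; apply/eqP; rewrite -subr_eq0; apply/eqP.
apply: (@eq0_small _ _ (c + c')) => [|e e0 _]; first exact: addr_ge0.
have [z gz] := section_approximation gb e0.
rewrite -(subrK (pairing f z) a) -addrA mulrDl.
by apply: le_trans (ler_normD _ _) _; rewrite lerD ?ac// distrC ac'.
Qed.

Lemma has_innerD f f' g a a' :
  has_inner f g a -> has_inner f' g a' -> has_inner (f + f') g (a + a').
Proof.
move=> [c [c0 ac]] [c' [c'0 ac']]; exists (c + c').
split=> [|e z gz]; first exact: addr_ge0.
rewrite pairingD opprD addrACA mulrDl.
by apply: le_trans (ler_normD _ _) _; rewrite lerD ?ac ?ac'.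
Qed.

Lemma has_innerZ b f g a : has_inner f g a -> has_inner (b *: f) g (b * a).
Proof.
move=> [c [c0 ac]]; exists (`|b| * c); split=> [|e z gz]; first exact: mulr_ge0.
by rewrite pairingZ -mulrBr normrM -mulrA ler_wpM2l// ac.
Qed.

Lemma gram_norm_near g b z e : dominated g b -> dominated (g - section z) e ->
  gram_norm z <= b + e.
Proof.
move=> gb gz; apply: gram_norm_le.
by have := dominatedB gb gz; rewrite opprB addrC subrK.
Qed.

(** With z close to f and z' close to g, both inner products are close to the inner
    product of the combinations z and z', which is hermitian. *)
Lemma has_innerC f g c b a : dominated f c -> dominated g b ->
  has_inner f g a -> has_inner g f a^*.
Proof.
move=> fc gb [d [d0 ad]]; have [b0 _] := gb; exists b; split=> // e z fz.
have [e0 _] := fz.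
apply: (@le_of_le_small _ _ _ (d + e + gram_norm z)) => [|e' e'0 _].
  by rewrite !addr_ge0 ?gram_norm_ge0.
have [z' gz'] := section_approximation gb e'0.
have -> : a^* - pairing g z = ((a - pairing f z') + (pairing f z' - gram k z z'))^*
    + (gram k z' z - pairing g z).
  by rewrite !(rmorphD, rmorphN) /= -gramC; ring.
have h1 := ad _ _ gz'.
have h2 : `|pairing f z' - gram k z z'| <= e * (b + e').
  rewrite -pairing_section -pairingB; apply: le_trans (fz.2 _) _.
  by rewrite ler_wpM2l// (gram_norm_near gb gz').
have h3 : `|gram k z' z - pairing g z| <= e' * gram_norm z.
  by rewrite distrC -pairing_section -pairingB; exact: gz'.2.
apply: le_trans (ler_normD _ _) _; rewrite norm_conjC.
apply: le_trans (lerD (le_trans (ler_normD _ _) (lerD h1 h2)) h3) _.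
by rewrite le_eqVlt; apply/orP; left; apply/eqP; ring.
Qed.

Lemma has_inner_section f c v : dominated f c -> has_inner f (section v) (pairing f v).
Proof.
move=> fc; have [c0 _] := fc; exists c; split=> // e z vz.
have vv : dominated (section v - section v) 0.
  by rewrite subrr; split=> // w; rewrite mul0r /pairing big1 ?normr0// => p _; rewrite mulr0.
by have := pairing_near fc vv vz; rewrite add0r.
Qed.

Lemma has_inner_ge0 f c a : dominated f c -> has_inner f f a -> 0 <= a.
Proof.
move=> fc fa; have [c0 _] := fc.
have ar : a \is Num.real.
  by rewrite CrealE (has_inner_uniq fc (has_innerC fc fc fa) fa).
have [d [d0 ad]] := fa.
apply: (@le_of_le_small _ _ _ (d + (c + 1))) => [|e e0 e1].
  by rewrite !addr_ge0.
have [z fz] := section_approximation fc e0.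
have h : `|a - gram k z z| <= (d + (c + 1)) * e.
  rewrite -[a](subrK (pairing f z)) -addrA mulrDl.
  apply: le_trans (ler_normD _ _) _; rewrite lerD ?ad//.
  rewrite -pairing_section -pairingB; apply: le_trans (fz.2 _) _.
  rewrite mulrC ler_wpM2r ?(ltW e0)//.
  by apply: le_trans (gram_norm_near fc fz) _; rewrite lerD2l.
apply: le_trans (kernel_ge0 k z) _; rewrite -lerBlDl.
apply: le_trans h; rewrite -normrN opprB; apply: real_ler_norm.
by rewrite rpredB// ger0_real// kernel_ge0.
Qed.

Lemma has_inner_le f c a : dominated f c -> has_inner f f a -> `|a| <= c ^+ 2.
Proof.
move=> fc [d [d0 ad]]; have [c0 _] := fc.
apply: (@le_of_le_small _ _ _ (d + c)) => [|e e0 _]; first exact: addr_ge0.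
have [z fz] := section_approximation fc e0.
rewrite -[a](subrK (pairing f z)); apply: le_trans (ler_normD _ _) _.
have h : `|pairing f z| <= c * (c + e).
  by apply: le_trans (fc.2 z) _; rewrite ler_wpM2l// (gram_norm_near fc fz).
apply: le_trans (lerD (ad _ _ fz) h) _.
by rewrite le_eqVlt; apply/orP; left; apply/eqP; ring.
Qed.

(** Membership is a norm bound and not the existence of an approximating sequence,
    so that a limit of elements is visibly an element. *)
Definition bounded_functional : {pred X -> R[i]} :=
  fun f => `[< exists c, dominated f c >].

Lemma bounded_functionalP f :
  reflect (exists c, dominated f c) (f \in bounded_functional).
Proof. exact: asboolP. Qed.

Lemma bounded_functional_submod : submod_closed bounded_functional.
Proof.
split=> [|a f g /bounded_functionalP[c fc] /bounded_functionalP[e ge]].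
  apply/bounded_functionalP; exists 0; split=> // w.
  by rewrite mul0r /pairing big1 ?normr0// => p _; rewrite mulr0.
apply/bounded_functionalP; exists (`|a| * c + e).
by apply: dominatedD => //; exact: dominatedZ.
Qed.

HB.instance Definition _ := GRing.isSubmodClosed.Build _ _ bounded_functional
  bounded_functional_submod.

Record rkhs := RKHS {
  rkhs_fun :> X -> R[i];
  rkhsP : rkhs_fun \in bounded_functional
}.

HB.instance Definition _ := [isSub for rkhs_fun].
HB.instance Definition _ := [Choice of rkhs by <:].
HB.instance Definition _ := [SubChoice_isSubLmodule of rkhs by <:].

Lemma rkhs_dominated (f : rkhs) : exists c, dominated f c.
Proof. exact/bounded_functionalP/rkhsP. Qed.

Definition rkhs_inner (f g : rkhs) : R[i] := xget 0 [set a | has_inner f g a].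

Lemma rkhs_innerP (f g : rkhs) : has_inner f g (rkhs_inner f g).
Proof.
rewrite /rkhs_inner; case: xgetP => // none.
have [[c fc] [b gb]] := (rkhs_dominated f, rkhs_dominated g).
by have [a /none] := has_inner_ex fc gb.
Qed.

Lemma rkhs_inner_eq (f g : rkhs) a : has_inner f g a -> rkhs_inner f g = a.
Proof.
by move=> fa; have [b gb] := rkhs_dominated g; exact: has_inner_uniq gb (rkhs_innerP _ _) fa.
Qed.

Lemma rkhs_innerC (f g : rkhs) : rkhs_inner f g = (rkhs_inner g f)^*.
Proof.
apply: rkhs_inner_eq.
have [[c fc] [b gb]] := (rkhs_dominated f, rkhs_dominated g).
exact: has_innerC gb fc (rkhs_innerP _ _).
Qed.

Lemma rkhs_innerDl (f f' g : rkhs) :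
  rkhs_inner (f + f') g = rkhs_inner f g + rkhs_inner f' g.
Proof. by apply: rkhs_inner_eq; apply: has_innerD; exact: rkhs_innerP. Qed.

Lemma rkhs_innerZl a (f g : rkhs) : rkhs_inner (a *: f) g = a * rkhs_inner f g.
Proof. by apply: rkhs_inner_eq; apply: has_innerZ; exact: rkhs_innerP. Qed.

Lemma rkhs_innerDr (f g g' : rkhs) :
  rkhs_inner f (g + g') = rkhs_inner f g + rkhs_inner f g'.
Proof. by rewrite rkhs_innerC rkhs_innerDl rmorphD /= -!rkhs_innerC. Qed.

Lemma rkhs_innerZr a (f g : rkhs) : rkhs_inner f (a *: g) = a^* * rkhs_inner f g.
Proof. by rewrite rkhs_innerC rkhs_innerZl rmorphM /= -rkhs_innerC. Qed.

Lemma rkhs_inner_ge0 (f : rkhs) : 0 <= rkhs_inner f f.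
Proof. by have [c fc] := rkhs_dominated f; exact: has_inner_ge0 fc (rkhs_innerP _ _). Qed.

Lemma rkhs_CauchySchwarz (f g : rkhs) :
  `|rkhs_inner f g| <= sqrtC (rkhs_inner f f) * sqrtC (rkhs_inner g g).
Proof.
apply: quadratic_CauchySchwarz; rewrite ?rkhs_inner_ge0// => s t.
have := rkhs_inner_ge0 (s *: f + t *: g); apply: eq_ind; congr (0 <= _).
rewrite !(rkhs_innerDl, rkhs_innerDr, rkhs_innerZl, rkhs_innerZr).
rewrite !rmorphM /= conjCK -rkhs_innerC; ring.
Qed.

Lemma section_rkhsP v : section v \in bounded_functional.
Proof. by apply/bounded_functionalP; exists (gram_norm v); exact: dominated_section. Qed.

Definition rkhs_section v : rkhs := RKHS (section_rkhsP v).

Lemma rkhs_inner_section (f : rkhs) v : rkhs_inner f (rkhs_section v) = pairing f v.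
Proof.
by have [c fc] := rkhs_dominated f; apply: rkhs_inner_eq; exact: has_inner_section fc.
Qed.

Definition rkhs_norm (f : rkhs) : R[i] := sqrtC (rkhs_inner f f).

Lemma rkhs_norm_dominated (f : rkhs) : dominated f (rkhs_norm f).
Proof.
split=> [|w]; first by rewrite sqrtC_ge0 rkhs_inner_ge0.
have := rkhs_CauchySchwarz f (rkhs_section w).
by rewrite !rkhs_inner_section /= pairing_section.
Qed.

Lemma rkhs_norm_le (f : rkhs) c : dominated f c -> rkhs_norm f <= c.
Proof.
move=> fc; have [c0 _] := fc.
rewrite -(@ler_pXn2r _ 2) ?nnegrE ?sqrtC_ge0 ?rkhs_inner_ge0// sqrtCK.
by apply: le_trans (has_inner_le fc (rkhs_innerP _ _)); rewrite ger0_norm ?rkhs_inner_ge0.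
Qed.

Lemma rkhs_normD (f g : rkhs) : rkhs_norm (f + g) <= rkhs_norm f + rkhs_norm g.
Proof. by apply: rkhs_norm_le; apply: dominatedD; exact: rkhs_norm_dominated. Qed.

Lemma rkhs_normZ a (f : rkhs) : rkhs_norm (a *: f) = `|a| * rkhs_norm f.
Proof.
rewrite /rkhs_norm rkhs_innerZl rkhs_innerZr mulrA -normCK.
by rewrite sqrtCM ?nnegrE ?exprn_ge0 ?rkhs_inner_ge0// sqrCK.
Qed.

Lemma rkhs_norm_eq0 (f : rkhs) : rkhs_norm f = 0 -> f = 0.
Proof.
move=> f0; apply/val_inj/funext => x.
have := (rkhs_norm_dominated f).2 [:: (1, x)].
by rewrite f0 mul0r pairing1 normr_le0 => /eqP.
Qed.

HB.instance Definition _ := Lmodule_isNormed.Build R[i] rkhs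
  rkhs_normD rkhs_normZ rkhs_norm_eq0.

Lemma rkhs_norm_dist (f g : rkhs) e :
  0 < e -> ball f e g -> dominated ((f : X -> R[i]) - g) e.
Proof.
move=> e0; rewrite -ball_normE /= => fg.
exact: dominated_le (ltW fg) (rkhs_norm_dominated (f - g)).
Qed.

(** The values at a point x of the functions close to the limit of F lie in discs
    that are pairwise compatible, which yields the value at x of a limit function;
    the norm bounds pass to the limit because a combination involves finitely many
    points. *)
Lemma rkhs_complete (F : set_system rkhs) : ProperFilter F -> cauchy F -> cvg F.
Proof.
move=> FF /cauchyP Fc.
have D (i j : R[i] * rkhs) : 0 < i.1 -> F (ball i.2 i.1) -> 0 < j.1 -> F (ball j.2 j.1) ->
    dominated ((i.2 : X -> R[i]) - j.2) (i.1 + j.1).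
  move=> i0 Fi j0 Fj; have [h [ih jh]] := filter_ex (filterI Fi Fj).
  exact: dominatedB_trans (rkhs_norm_dist i0 ih) (dominatedB_sym (rkhs_norm_dist j0 jh)).
have /choice[f fP] : forall x, exists y, forall i : R[i] * rkhs,
    0 < i.1 -> F (ball i.2 i.1) -> `|y - i.2 x| <= 2 * (i.1 * gram_norm [:: (1, x)]).
  move=> x; have [i j [i0 Fi] [j0 Fj]|y yP] := @disc_point R _
      [set i : R[i] * rkhs | 0 < i.1 /\ F (ball i.2 i.1)]
      (fun i => i.2 x) (fun i => i.1 * gram_norm [:: (1, x)]).
    rewrite -mulrDl; have := (D i j i0 Fi j0 Fj).2 [:: (1, x)].
    by rewrite pairing1.
  by exists y => i i0 Fi; apply: yP.
have fD (i : R[i] * rkhs) : 0 < i.1 -> F (ball i.2 i.1) -> dominated (f - i.2) i.1.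
  move=> i0 Fi; split=> [|w]; first exact: ltW.
  pose M := \sum_(p <- w) `|p.1| * (2 * gram_norm [:: (1, p.2)]).
  have M0 : 0 <= M.
    by apply: sumr_ge0 => p _; rewrite !mulr_ge0 ?gram_norm_ge0.
  apply: (@le_of_le_small _ _ _ (M + gram_norm w)) => [|e e0 _].
    by rewrite addr_ge0 ?gram_norm_ge0.
  have [g Fg] := Fc _ e0.
  have -> : f - i.2 = (f - g) + ((g : X -> R[i]) - i.2) by rewrite addrA subrK.
  rewrite pairingD; apply: le_trans (ler_normD _ _) _.
  have h1 : `|pairing (f - g) w| <= M * e.
    apply: le_trans (ler_norm_sum _ _ _) _; rewrite mulr_suml; apply: ler_sum => p _.
    rewrite normrM norm_conjC -mulrA ler_wpM2l//.
    by apply: le_trans (fP _ (e, g) e0 Fg) _; rewrite /= [e * _]mulrC mulrA.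
  apply: le_trans (lerD h1 ((D (e, g) i e0 Fg i0 Fi).2 w)) _ => /=.
  by rewrite le_eqVlt; apply/orP; left; apply/eqP; ring.
have fb : f \in bounded_functional.
  have [g Fg] := Fc _ (@ltr01 R[i]).
  apply/bounded_functionalP; exists (1 + rkhs_norm g).
  have := dominatedD (fD (1, g) ltr01 Fg) (rkhs_norm_dominated g).
  by rewrite subrK.
apply/cvg_ex; exists (RKHS fb); apply/cvg_ballP => e e0.
have e40 : 0 < e / 2 / 2 by rewrite !divr_gt0.
have [g Fg] := Fc _ e40.
apply: filterS (Fg) => h gh; rewrite -ball_normE /=.
have := dominatedB_trans (fD (_, g) e40 Fg) (rkhs_norm_dist e40 gh).
rewrite -splitr => /(@rkhs_norm_le (RKHS fb - h)) /le_lt_trans; apply.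
by rewrite ltr_pdivrMr// ltr_pMr// ltr1n.
Qed.

HB.instance Definition _ := Uniform_isComplete.Build rkhs rkhs_complete.

Lemma rkhs_bilinear :
  bilinear_for *%R (Num.conj \; *%R) rkhs_inner.
Proof.
split=> [g a f f'|f a g g']; first by rewrite rkhs_innerDl rkhs_innerZl.
by rewrite rkhs_innerDr rkhs_innerZr.
Qed.
HB.instance Definition _ := bilinear_isBilinear.Build R[i] rkhs rkhs R[i]
  _ _ rkhs_inner rkhs_bilinear.

Lemma rkhs_hermitian (f g : rkhs) :
  rkhs_inner f g = (-1) ^+ false * (@Num.conj R[i]) (rkhs_inner g f).
Proof. by rewrite expr0 mul1r; exact: rkhs_innerC. Qed.
HB.instance Definition _ := isHermitianSesquilinear.Build R[i] rkhs false
  (@Num.conj R[i]) rkhs_inner rkhs_hermitian.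

Lemma rkhs_inner_gt0 (f : rkhs) : f != 0 -> 0 < rkhs_inner f f.
Proof.
move=> f0; rewrite lt_neqAle rkhs_inner_ge0 andbT eq_sym.
by apply: contra f0 => /eqP h; rewrite [f]rkhs_norm_eq0// /rkhs_norm h sqrtC0.
Qed.
HB.instance Definition _ := isDotProduct.Build R[i] rkhs rkhs_inner rkhs_inner_gt0.

Definition rkhs_dot : {dot rkhs for (@Num.conj R[i])} := rkhs_inner.

Lemma rkhs_sqr_normE (f : rkhs) : `|f| ^+ 2 = rkhs_dot f f.
Proof. exact: sqrtCK. Qed.

HB.instance Definition _ := CompleteNormedModule_isHilbert.Build R rkhs rkhs_sqr_normE.

End InnerRelation.

(** * Bounded operators *)

Section Operators.
Context {R : realType} {H K : hilbertType R}.

Section MakeOperator.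
Variables (f : H -> K) (f_linear : linear f) (c : R).
Hypothesis f_bound : forall x, `|f x| <= c%:C * `|x|.

Let f_lin : {linear H -> K} := HB.pack f (GRing.isLinear.Build R[i] H K *:%R f f_linear).

Lemma linear_bound_near : bounded_near f_lin (nbhs (0 : H)).
Proof.
apply/linear_boundedP; exists c%:C; split; first by rewrite complex_real.
by move=> b /ltW cb x; apply: le_trans (f_bound x) _; rewrite ler_wpM2r.
Qed.

Definition make_operator : bounded_operator H K := BoundedOperator linear_bound_near.

End MakeOperator.

Lemma inner_ext (y z : H) : (forall x, inner x y = inner x z) -> y = z.
Proof.
move=> yz; apply/eqP; rewrite -subr_eq0 -normr_eq0 -sqrf_eq0 sqr_normE.
by rewrite innerDr innerNr yz subrr.
Qed.

Lemma adjoint_eq (f : bounded_operator H K) y z :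
  (forall x, inner (f x) y = inner x z) -> adjoint f y = z.
Proof. by move=> fy; apply: inner_ext => x; rewrite -adjointP. Qed.

End Operators.

(** * Dilation of positive definite functions *)

Section KernelTranslation.
Context {R : realType} {X : Type} {k : positive_kernel R X}.
Implicit Types (f g : rkhs k) (v w z : seq (R[i] * X)).
Variables (tau sigma : X -> X).
Hypotheses (tauK : forall x y, k (tau x) (tau y) = k x y) (sigmaK : cancel sigma tau).

(** A map tau of X acts on functions by composition, and on combinations by moving
    their points. *)
Definition push w : seq (R[i] * X) := [seq (p.1, tau p.2) | p <- w].

Lemma gram_push v w : gram k (push v) (push w) = gram k v w.
Proof.
rewrite /gram /push big_map; apply: eq_bigr => p _; rewrite big_map.
by apply: eq_bigr => q _ /=; rewrite tauK.
Qed.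

Lemma pairing_comp (f : X -> R[i]) w : pairing (f \o tau) w = pairing f (push w).
Proof. by rewrite /pairing /push big_map. Qed.

Lemma dominated_comp (f : X -> R[i]) c : dominated k f c -> dominated k (f \o tau) c.
Proof.
by move=> [c0 fc]; split=> // w; rewrite pairing_comp -[gram_norm k w]/(sqrtC _) -gram_push fc.
Qed.

Lemma comp_rkhsP (f : rkhs k) : ((f : X -> R[i]) \o tau) \in bounded_functional k.
Proof.
apply/bounded_functionalP; exists (rkhs_norm f).
exact/dominated_comp/rkhs_norm_dominated.
Qed.

Definition rkhs_comp f : rkhs k := RKHS (comp_rkhsP f).

Lemma section_comp_inv z : kernel_section k z \o sigma = kernel_section k (push z).
Proof.
apply/funext => y; rewrite /kernel_section /push big_map /=.
by apply: eq_bigr => p _; rewrite /= -tauK sigmaK.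
Qed.

End KernelTranslation.

Section KernelTranslationInverse.
Context {R : realType} {X : Type} {k : positive_kernel R X}.
Variables (tau sigma : X -> X).
Hypotheses (tauK : forall x y, k (tau x) (tau y) = k x y).
Hypotheses (sigmaK : forall x y, k (sigma x) (sigma y) = k x y).
Hypotheses (st : cancel sigma tau).

(** The adjoint of composition with tau is composition with its inverse sigma:
    composing the function of a combination with sigma moves the points of the
    combination by tau. *)
Lemma rkhs_inner_comp (f g : rkhs k) :
  rkhs_inner (rkhs_comp tauK f) g = rkhs_inner f (rkhs_comp sigmaK g).
Proof.
apply: rkhs_inner_eq; have [c [c0 fg]] := rkhs_innerP f (rkhs_comp sigmaK g).
exists c; split=> // e z gz; rewrite /= pairing_comp; apply: fg => /=.
rewrite -(section_comp_inv tauK st).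
exact: (dominated_comp sigmaK gz).
Qed.

Lemma rkhs_comp_section z :
  rkhs_comp sigmaK (rkhs_section k z) = rkhs_section k (push tau z).
Proof. by apply/val_inj => /=; rewrite -(section_comp_inv tauK st). Qed.

End KernelTranslationInverse.

(** A family phi of sesquilinear forms on H indexed by a vector group is treated as
    the scalar kernel phi (s - t) u v on pairs (s, u), (t, v). *)
Section Naimark.
Context {R : realType} {d : nat} {H : hilbertType R}.
Variable phi : 'rV[R]_d -> H -> H -> R[i].
Hypothesis phiDl : forall t u u' v, phi t (u + u') v = phi t u v + phi t u' v.
Hypothesis phiZl : forall t a u v, phi t (a *: u) v = a * phi t u v.
Hypothesis phiC : forall t u v, phi (- t) v u = (phi t u v)^*.
Hypothesis phi0 : forall u v, phi 0 u v = inner u v.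
Hypothesis phi_continuous : forall u v, continuous (fun t => phi t u v : R[i]^o).
Hypothesis phi_pos : forall w : seq ('rV[R]_d * H),
  0 <= complex.Re (\sum_(p <- w) \sum_(q <- w) phi (p.1 - q.1) p.2 q.2).

Let X := ('rV[R]_d * H)%type.
Let kfun (x y : X) := phi (x.1 - y.1) x.2 y.2.

Let kfunC x y : kfun x y = (kfun y x)^*.
Proof. by rewrite /kfun -phiC opprB. Qed.

(** The coefficients of a combination are absorbed in the vectors. *)
Let kfun_ge0 w : 0 <= gram kfun w w.
Proof.
have phiZr t a u v : phi t u (a *: v) = a^* * phi t u v.
  by rewrite -[t]opprK phiC phiZl rmorphM /= -phiC.
have gr : gram kfun w w \is Num.real.
  rewrite CrealE; apply/eqP; rewrite rmorph_sum /= /gram [RHS]exchange_big.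
  apply: eq_bigr => p _ /=; rewrite rmorph_sum; apply: eq_bigr => q _ /=.
  by rewrite !rmorphM /= conjCK -kfunC; congr (_ * _); ring.
rewrite -(RRe_real gr) ler0c.
have := phi_pos [seq (p.2.1, p.1 *: p.2.2) | p <- w].
rewrite big_map; apply: eq_ind; congr (0 <= complex.Re _).
apply: eq_bigr => p _; rewrite big_map; apply: eq_bigr => q _ /=.
by rewrite phiZl phiZr mulrA.
Qed.

Let k : positive_kernel R X := PositiveKernel kfunC kfun_ge0.
Let tau (s : 'rV[R]_d) (x : X) : X := (x.1 - s, x.2).

Let tau_inv s x y : k (tau s x) (tau s y) = k x y.
Proof. by rewrite /= /kfun /tau /= opprB addrA subrK. Qed.

Let tauK s : cancel (tau s) (tau (- s)).
Proof. by case=> t u; rewrite /tau /= opprK subrK. Qed.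

Let tauNK s : cancel (tau (- s)) (tau s).
Proof. by case=> t u; rewrite /tau /= opprK addrK. Qed.

Let Ufun s (f : rkhs k) : rkhs k := rkhs_comp (tau_inv s) f.

Let Ufun_linear s : linear (Ufun s).
Proof. by move=> a f g; apply/val_inj. Qed.

Let inner_Ufun s f g : rkhs_inner (Ufun s f) g = rkhs_inner f (Ufun (- s) g).
Proof. exact: rkhs_inner_comp (tauNK s) f g. Qed.

Let Ufun0 f : Ufun 0 f = f.
Proof. by apply/val_inj/funext => -[t u] /=; rewrite /tau /= subr0. Qed.

Let UfunD s t f : Ufun (s + t) f = Ufun s (Ufun t f).
Proof. by apply/val_inj/funext => -[q u] /=; rewrite /tau /= opprD addrA. Qed.

Let Ufun_norm s f : `|Ufun s f| = `|f|.
Proof.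
rewrite -[LHS]/(sqrtC _) -[RHS]/(sqrtC _); congr sqrtC.
by rewrite inner_Ufun -UfunD addNr Ufun0.
Qed.

Let Ufun_bound s f : `|Ufun s f| <= 1%:C * `|f|.
Proof. by rewrite Ufun_norm mul1r. Qed.

Let U s : bounded_operator (rkhs k) (rkhs k) := make_operator (@Ufun_linear s) (@Ufun_bound s).

Let adjointU s f : adjoint (U s) f = U (- s) f.
Proof. by apply: adjoint_eq => g; exact: inner_Ufun. Qed.

Let rfun (u : H) : rkhs k := rkhs_section k [:: (1, (0, u))].

Let rfunE u t v : rfun u (t, v) = phi (- t) u v.
Proof. by rewrite /= /kernel_section big_seq1 mul1r /= /kfun /= sub0r. Qed.

Let rfun_linear : linear rfun.
Proof.
move=> a u u'; apply/val_inj/funext => -[t v]; rewrite -[LHS]/(rfun _ _).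
by rewrite -[RHS]/(a * rfun u (t, v) + rfun u' (t, v)) !rfunE phiDl phiZl.
Qed.

Let inner_U s u v : rkhs_inner (U s (rfun u)) (rfun v) = phi s u v.
Proof.
rewrite rkhs_inner_section pairing1 -[LHS]/(rfun u (tau s (0, v))).
by rewrite rfunE /= opprB subr0.
Qed.

Let rfun_bound u : `|rfun u| <= 1%:C * `|u|.
Proof.
rewrite mul1r le_eqVlt; apply/orP; left; apply/eqP.
rewrite -(sqrCK (normr_ge0 u)) sqr_normE -phi0 -inner_U -[LHS]/(sqrtC _); congr sqrtC.
by rewrite -[U _ _]/(Ufun _ _) Ufun0.
Qed.

Let r : bounded_operator H (rkhs k) := make_operator rfun_linear rfun_bound.

Let Ufun_section s z : Ufun s (rkhs_section k z) = rkhs_section k (push (tau (- s)) z).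
Proof. exact: rkhs_comp_section (tauK s) z. Qed.

Let gram_translate0 q z : gram k (push (tau (q - q)) z) z = gram k z z.
Proof.
congr gram; rewrite /push -[RHS]map_id; apply: eq_map => -[a [q' u]] /=.
by rewrite /tau /= subrr subr0.
Qed.

Let section_displacement s t z : `|U s (rkhs_section k z) - U t (rkhs_section k z)| ^+ 2 =
  (gram k z z - gram k (push (tau (t - s)) z) z)
  + (gram k z z - gram k (push (tau (t - s)) z) z)^*.
Proof.
rewrite sqr_normE; set S := rkhs_section k z.
have h q q' : inner (U q S) (U q' S) = gram k (push (tau (q' - q)) z) z.
  rewrite -[LHS]/(rkhs_inner (Ufun q S) (Ufun q' S)) -{1}[q']opprK -inner_Ufun -UfunD.
  by rewrite Ufun_section rkhs_inner_section pairing_section opprD opprK.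
have hC : gram k (push (tau (s - t)) z) z = (gram k (push (tau (t - s)) z) z)^*.
  by rewrite -!h innerC.
rewrite !(innerDl, innerDr, innerNl, innerNr) !h !gram_translate0 hC rmorphB /= -(gramC k z z).
ring.
Qed.

(** On combinations of the points, strong continuity amounts to the continuity of
    finitely many of the scalar functions phi ^~ u v. *)
Let gram_translate_continuous (s : 'rV[R]_d) z :
  continuous (fun t : 'rV[R]_d => gram k (push (tau (t - s)) z) z : R[i]^o).
Proof.
have tr (p q : 'rV[R]_d) : continuous (fun t : 'rV[R]_d => p - (t - s) - q).
  move=> t; apply: (@continuousB R 'rV[R]_d 'rV[R]_d (fun t => p - (t - s)) (cst q) t).
    apply: (@continuousB R 'rV[R]_d 'rV[R]_d (cst p) (fun t => t - s) t).
      exact: cst_continuous.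
    by apply: (@continuousB R 'rV[R]_d 'rV[R]_d id (cst s) t);
      [exact: cvg_id|exact: cst_continuous].
  exact: cst_continuous.
rewrite (_ : (fun t : 'rV[R]_d => _) = fun t => \sum_(p <- z) \sum_(q <- z)
    p.1 * q.1^* * phi (p.2.1 - (t - s) - q.2.1) p.2.2 q.2.2); last first.
  by apply/funext => t; rewrite /gram /push big_map.
apply: continuous_big => [|p _]; first exact: add_continuous.
apply: continuous_big => [|q _ t]; first exact: add_continuous.
apply: (@continuousM R[i] _ (cst (p.1 * q.1^*))); first exact: cst_continuous.
exact: (continuous_comp (@tr _ _ t) (@phi_continuous _ _ _)).
Qed.

Let section_continuous z s e : 0 < e ->
  \forall t \near s, `|U s (rkhs_section k z) - U t (rkhs_section k z)| < e.
Proof.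
move=> e0; have e2 : 0 < e ^+ 2 / 2 by rewrite divr_gt0// exprn_gt0.
have := @gram_translate_continuous s z s; rewrite /continuous_at gram_translate0.
move/(@cvgrPdist_lt _ _ _ (nbhs s)) => /(_ _ e2); apply: filterS => t ht.
rewrite -(@ltr_pXn2r _ 2) ?nnegrE ?(ltW e0)// section_displacement.
set b := gram k z z - _ in ht *.
have := ler_normD b b^*; rewrite norm_conjC => hb.
apply: (@le_lt_trans _ _ `|b + b^*|); first last.
  by apply: le_lt_trans hb _; rewrite [X in _ < X]splitr ltrD.
apply: real_ler_norm.
by rewrite CrealE rmorphD /= conjCK addrC.
Qed.

(** The representation is isometric, so strong continuity on the dense set of
    combinations is enough. *)
Let U_continuous f : continuous (U ^~ f).
Proof.
move=> s; apply/(@cvgrPdist_lt _ _ _ (nbhs s)) => e e0.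
have e20 : 0 < e / 2 by rewrite divr_gt0.
have e40 : 0 < e / 2 / 2 by rewrite divr_gt0.
have [z fz] := section_approximation (rkhs_norm_dominated f) e40.
have {}fz : `|f - rkhs_section k z| <= e / 2 / 2 by exact: rkhs_norm_le.
apply: filterS (section_continuous z s e20) => t ht.
have -> : U s f - U t f = U s (f - rkhs_section k z)
    + (U s (rkhs_section k z) - U t (rkhs_section k z)) - U t (f - rkhs_section k z).
  by rewrite !linearB /= subrKA opprK addrACA addNr addr0.
apply: le_lt_trans (ler_normB _ _) _.
rewrite [X in _ < X]splitr [X in _ < X + _]splitr.
rewrite -[ltRHS]addrA [X in _ < _ + X]addrC [ltRHS]addrA.
apply: ltr_leD; last by rewrite [`|_|]Ufun_norm.
apply: le_lt_trans (ler_normD _ _) _.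
by apply: ler_ltD => //; rewrite [`|_|]Ufun_norm.
Qed.

Theorem naimark_dilation : exists (K : hilbertType R)
    (U : 'rV[R]_d -> bounded_operator K K) (r : bounded_operator H K),
  unitary_representation U /\ forall t u v, inner (U t (r u)) (r v) = phi t u v.
Proof.
exists (rkhs k), U, r; split; last exact: inner_U.
split.
- by move=> t; split=> x; rewrite adjointU -[LHS]/(Ufun _ (Ufun _ _)) -UfunD
     ?(addNr, subrr) Ufun0.
- exact: Ufun0.
- by move=> s t x; exact: UfunD.
- exact: U_continuous.
Qed.
End Naimark.

(** * Bounded sesquilinear forms *)

Section BoundedForms.
Context {R : realType} {H : hilbertType R}.
Implicit Types (beta : H -> H -> R[i]) (u v : H).

Record bounded_form beta : Prop := {
  bformDl : forall u u' v, beta (u + u') v = beta u v + beta u' v;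
  bformDr : forall u v v', beta u (v + v') = beta u v + beta u v';
  bformZl : forall a u v, beta (a *: u) v = a * beta u v;
  bformZr : forall a u v, beta u (a *: v) = a^* * beta u v;
  bform_bound : exists2 c, 0 <= c & forall u v, `|beta u v| <= c * (`|u| * `|v|)
}.

Lemma bform0l beta v : bounded_form beta -> beta 0 v = 0.
Proof. by move=> h; rewrite -(scale0r (0 : H)) bformZl// mul0r. Qed.

Lemma bform0r beta u : bounded_form beta -> beta u 0 = 0.
Proof. by move=> h; rewrite -(scale0r (0 : H)) bformZr// rmorph0 mul0r. Qed.

Lemma bformBl beta u u' v : bounded_form beta -> beta (u - u') v = beta u v - beta u' v.
Proof. by move=> h; rewrite -scaleN1r bformDl// bformZl// mulN1r. Qed.

Lemma bformBr beta u v v' : bounded_form beta -> beta u (v - v') = beta u v - beta u v'.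
Proof. by move=> h; rewrite -scaleN1r bformDr// bformZr// rmorphN rmorph1 mulN1r. Qed.

Lemma bform_suml beta (I : finType) (u : I -> H) v : bounded_form beta ->
  beta (\sum_i u i) v = \sum_i beta (u i) v.
Proof.
move=> h; elim/big_ind2: _ => [|u1 b1 u2 b2 <- <-|//]; first exact: bform0l.
exact: bformDl.
Qed.

Lemma bform_sumr beta (I : finType) u (v : I -> H) : bounded_form beta ->
  beta u (\sum_i v i) = \sum_i beta u (v i).
Proof.
move=> h; elim/big_ind2: _ => [|u1 b1 u2 b2 <- <-|//]; first exact: bform0r.
exact: bformDr.
Qed.

Lemma bounded_form_inner : bounded_form (inner : H -> H -> R[i]).
Proof.
split.
- exact: innerDl.
- exact: innerDr.
- exact: innerZl.
- exact: innerZr.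
- by exists 1 => // u v; rewrite mul1r inner_CauchySchwarz.
Qed.

Lemma operator_bound_ge0 (P : bounded_operator H H) :
  exists2 c : R[i], 0 <= c & forall u, `|P u| <= c * `|u|.
Proof.
have [c cP] := bounded_operatorP P; exists `|c|%:C; first by rewrite ler0c.
by move=> u; apply: le_trans (cP u) _; rewrite ler_wpM2r// lecR ler_norm.
Qed.

Lemma bounded_form_comp beta (P Q : bounded_operator H H) : bounded_form beta ->
  bounded_form (fun u v => beta (P u) (Q v)).
Proof.
move=> h; split=> *; rewrite ?linearD ?linearZ /=;
  rewrite ?(bformDl h) ?(bformDr h) ?(bformZl h) ?(bformZr h)//.
have [c c0 hc] := bform_bound h.
have [p p0 hp] := operator_bound_ge0 P; have [q q0 hq] := operator_bound_ge0 Q.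
exists (c * (p * q)) => [|u v]; first by rewrite !mulr_ge0.
apply: le_trans (hc _ _) _; rewrite -mulrA ler_wpM2l// mulrACA.
by rewrite ler_pM.
Qed.

Lemma bform_cvg beta (Z : Type) (F : set_system Z) (f g : Z -> H) u v :
    Filter F -> bounded_form beta ->
  f @ F --> u -> g @ F --> v -> (beta (f z) (g z) : R[i]^o) @[z --> F] --> (beta u v : R[i]^o).
Proof.
move=> FF h fu gv; have [c c0 hc] := bform_bound h.
apply/cvgrPdist_lt => e e0.
pose m := c * (1 + `|u| + `|v|) + 1.
have m0 : 0 < m by rewrite ltr_wpDl// mulr_ge0// !addr_ge0.
pose dl := e / (m + e).
have me : 0 < m + e by rewrite addr_gt0.
have d0 : 0 < dl by rewrite divr_gt0.
have d1 : dl <= 1 by rewrite /dl ler_pdivrMr// mul1r lerDr ltW.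
have hf := cvgr_dist_lt _ _ fu _ d0; have hg := cvgr_dist_lt _ _ gv _ d0.
near=> z.
have fz : `|u - f z| < dl by near: z; exact: hf.
have gz : `|v - g z| < dl by near: z; exact: hg.
have -> : beta u v - beta (f z) (g z) =
    beta (u - f z) v + beta u (v - g z) - beta (u - f z) (v - g z).
  by rewrite !(bformBl _ _ _ h) !(bformBr _ _ _ h); ring.
have h1 : `|beta (u - f z) v| <= c * (dl * `|v|).
  by apply: le_trans (hc _ _) _; rewrite ler_wpM2l// ler_wpM2r// ltW.
have h2 : `|beta u (v - g z)| <= c * (dl * `|u|).
  by apply: le_trans (hc _ _) _; rewrite ler_wpM2l// mulrC ler_wpM2r// ltW.
have h3 : `|beta (u - f z) (v - g z)| <= c * (dl * 1).
  apply: le_trans (hc _ _) _; rewrite ler_wpM2l// ler_pM// ?ltW//.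
  exact: lt_le_trans gz d1.
apply: le_lt_trans (ler_normB _ _) _.
apply: le_lt_trans (lerD (le_trans (ler_normD _ _) (lerD h1 h2)) h3) _.
apply: (@lt_trans _ _ (dl * m)).
  rewrite -subr_gt0 (_ : _ - _ = dl) // /m; ring.
by rewrite /dl mulrAC ltr_pdivrMr// ltr_pM2l// ltrDl.
Unshelve. all: by end_near. Qed.

End BoundedForms.

(** * Positive definiteness along a one-parameter semigroup *)

(** A continuous function whose left lower derivative is everywhere nonnegative is
    nondecreasing.  Adding e * t makes the derivative positive, and then a minimum
    on [a, b] can only be attained at a.  Left increments are
    the ones at hand: moving tau to the left by h applies S(h), whose derivative is
    known at h = 0 from the right. *)
Lemma le_of_left_increments (R : realType) (G : R -> R) (a b : R) : a <= b ->
    continuous G ->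
    (forall t e, a < t -> t <= b -> 0 < e -> \forall h \near 0^'+, G (t - h) <= G t + e * h) ->
  G a <= G b.
Proof.
move=> ab Gc Gd.
apply: (@le_of_le_small _ _ _ (b - a)) => [|e e0 _]; first by rewrite subr_ge0.
pose F t := G t + e * t.
suff : F a <= F b by rewrite /F; lra.
have Fc : continuous F.
  move=> t; apply: (@continuousD R R^o R G (fun t => e * t)); first exact: Gc.
  by apply: (@continuousM R R (cst e) id); [exact: cst_continuous|exact: cvg_id].
have [c] := EVT_min ab (continuous_subspaceT Fc).
rewrite in_itv /= => /andP[ac cb] cmin.
move: ac; rewrite le_eqVlt => /predU1P[->|ac].
  by apply: cmin; rewrite in_itv /= ab lexx.
have e20 : 0 < e / 2 by rewrite divr_gt0.
near (0:R)^'+ => h.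
have h0 : 0 < h by near: h; exact: nbhs_right_gt.
have hc : h < c - a by near: h; apply: nbhs_right_lt; rewrite subr_gt0.
have hG : G (c - h) <= G c + e / 2 * h by near: h; exact: Gd.
have : F c <= F (c - h) by apply: cmin; rewrite in_itv /=; apply/andP; split; lra.
have eh : 0 < e * h by rewrite mulr_gt0.
by rewrite /F mulrBr => hF; exfalso; move: hG hF; rewrite mulrAC; lra.
Unshelve. all: by end_near. Qed.

Lemma Re_continuous (R : realType) : continuous (@complex.Re R : R[i]^o -> R).
Proof.
move=> z; apply/(@cvgrPdist_lt _ _ _ (nbhs (z : R[i]^o))) => e e0.
have e0' : 0 < e%:C by rewrite ltcR.
have : \forall t \near (z : R[i]^o), `|(z : R[i]^o) - t| < e%:C.
  apply: (@cvgr_dist_lt R[i] R[i]^o _ (nbhs (z : R[i]^o)) _ id z _ _ e0'); exact: cvg_id.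
apply: filterS => t; rewrite -ltcR; apply: le_lt_trans.
by rewrite -ReB normc_ge_Re.
Qed.

Lemma max_sub_min (R : realDomainType) (x y : R) :
  Num.max (x - Num.min x y) 0 = Num.max (x - y) 0.
Proof.
case: (leP x y) => [xy|/ltW yx]; last by [].
by rewrite subrr maxxx max_r// subr_le0.
Qed.

Section PositiveDefinite.
Context {R : realType} {H : hilbertType R} {I : finType}.
Implicit Types (kappa : I -> I -> H -> H -> R[i]).

Definition positive_definite kappa : Prop := forall xi : I -> H,
  0 <= complex.Re (\sum_a \sum_b kappa a b (xi a) (xi b)).

(** Minus the derivative at h = 0 of beta (S(h) u, S(h) v), for a semigroup S with
    generator A. *)
Definition dissipation (A : H -> H) (beta : H -> H -> R[i]) : H -> H -> R[i] :=
  fun u v => - (beta (A u) v + beta u (A v)).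

Variables (S : R -> H -> H) (A : H -> H).
Hypothesis S0 : forall u, S 0 u = u.
Hypothesis SD : forall s t u, 0 <= s -> 0 <= t -> S (s + t) u = S s (S t u).
Hypothesis S_continuous : forall u, continuous (fun t : R => S (Num.max t 0) u).
Hypothesis S_derivative : forall u, (h^-1)%:C *: (S h u - u) @[h --> 0^'+] --> A u.
Hypothesis A0 : A 0 = 0.

(** The function G below increases from a value of the quadratic form of kappa to a
    value of that of the new kernel.  A term of G moves with tau exactly when
    tau <= t_a and tau <= t_b; these pairs form a product set, so the derivative at
    tau is a value of the quadratic form of the dissipation, at the vectors
    S(t_a - tau) xi_a for tau <= t_a and 0 for the other indices. *)
Lemma positive_definite_propagate kappa (t : I -> R) :
    (forall a b, bounded_form (kappa a b)) ->
    positive_definite kappa ->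
    positive_definite (fun a b => dissipation A (kappa a b)) ->
  positive_definite (fun a b u v =>
    kappa a b (S (Num.max (t a - t b) 0) u) (S (Num.max (t b - t a) 0) v)).
Proof.
move=> kb k0 k1 xi.
pose m a b tau := Num.min (Num.min (t a) (t b)) tau.
pose G tau := complex.Re (\sum_a \sum_b
  kappa a b (S (Num.max (t a - m a b tau) 0) (xi a)) (S (Num.max (t b - m a b tau) 0) (xi b))).
pose hi := \sum_a `|t a|.
have tle a : `|t a| <= hi by rewrite /hi (bigD1 a) //= lerDl sumr_ge0.
have thi a : t a <= hi by apply: le_trans (ler_norm _) (tle a).
have tlo a : - hi <= t a by rewrite lerNl; apply: le_trans (tle a); rewrite -normrN ler_norm.
have hi0 : 0 <= hi by exact: sumr_ge0.
have mc a b c : continuous (fun tau => c - m a b tau).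
  move=> tau; apply: (@continuousB R R^o R (cst c) (m a b)); first exact: cst_continuous.
  by apply: (@continuous_min R R (cst _) id); [exact: cst_continuous|exact: cvg_id].
have Gc : continuous G.
  move=> tau; apply: (@continuous_comp _ _ _
    (fun tau => \sum_a \sum_b kappa a b (S (Num.max (t a - m a b tau) 0) (xi a))
       (S (Num.max (t b - m a b tau) 0) (xi b)) : R[i]^o) (@complex.Re R));
    last exact: Re_continuous.
  apply: continuous_big => [|a _]; first exact: add_continuous.
  apply: continuous_big => [|b _ tau']; first exact: add_continuous.
  apply: bform_cvg => //.
    exact: (continuous_comp (@mc a b (t a) tau') (@S_continuous (xi a) _)).
  exact: (continuous_comp (@mc a b (t b) tau') (@S_continuous (xi b) _)).
have Glo : 0 <= G (- hi).
  (* At tau = - hi, to the left of all points, m does not depend on (a, b). *)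
  have := k0 (fun a => S (t a + hi) (xi a)); rewrite /G.
  apply: eq_ind; congr (0 <= complex.Re _); apply: eq_bigr => a _; apply: eq_bigr => b _.
  have -> : m a b (- hi) = - hi by apply/min_idPr; rewrite le_min !tlo.
  by rewrite opprK !max_l // -lerBlDr sub0r tlo.
have Ghi : G hi = complex.Re (\sum_a \sum_b
    kappa a b (S (Num.max (t a - t b) 0) (xi a)) (S (Num.max (t b - t a) 0) (xi b))).
  congr complex.Re; apply: eq_bigr => a _; apply: eq_bigr => b _.
  have -> : m a b hi = Num.min (t a) (t b) by apply/min_idPl; rewrite ge_min thi.
  by rewrite max_sub_min minC max_sub_min.
rewrite -Ghi; apply: le_trans Glo _; apply: le_of_left_increments => //; first lra.
move=> tau e _ _ e0.
pose u a := if tau <= t a then S (t a - tau) (xi a) else 0.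
(* The increment of the (a, b) term from tau to tau - h, divided by h. *)
pose q a b h := if (tau <= t a) && (tau <= t b) then
    kappa a b ((h^-1)%:C *: (S h (u a) - u a)) (S h (u b))
    + kappa a b (u a) ((h^-1)%:C *: (S h (u b) - u b)) else 0.
have Sh v : S h v @[h --> (0:R)^'+] --> v.
  have := @S_continuous v 0; rewrite /continuous_at maxxx S0 => /cvg_at_right_filter.
  apply: cvg_trans; apply: near_eq_cvg; near=> h.
  by rewrite max_l//; near: h; exact: nbhs_right_ge.
have qc a b : (q a b h : R[i]^o) @[h --> (0:R)^'+] -->
    (- dissipation A (kappa a b) (u a) (u b) : R[i]^o).
  rewrite /q /dissipation opprK; case: (boolP ((tau <= t a) && (tau <= t b))) => ab.
    apply: cvgD; apply: bform_cvg => //; exact: cvg_cst.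
  suff -> : kappa a b (A (u a)) (u b) + kappa a b (u a) (A (u b)) = 0 by exact: cvg_cst.
  move: ab; rewrite negb_and /u => /orP[/negPf ->|/negPf ->].
    by rewrite A0 !(bform0l _ (kb _ _)) addr0.
  by rewrite A0 !(bform0r _ (kb _ _)) addr0.
have Qc : complex.Re (\sum_a \sum_b q a b h) @[h --> (0:R)^'+] -->
    complex.Re (\sum_a \sum_b - dissipation A (kappa a b) (u a) (u b)).
  apply: (@cvg_comp _ _ _ (fun h => \sum_a \sum_b q a b h : R[i]^o) (@complex.Re R)
    _ _ _ _ (@Re_continuous R _)).
  apply: cvg_big => [|a _]; first exact: add_continuous.
  by apply: cvg_big => [|b _]; [exact: add_continuous|exact: qc].
have Qlt : \forall h \near (0:R)^'+, complex.Re (\sum_a \sum_b q a b h) < e.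
  apply: (cvgr_lt _ Qc); apply: le_lt_trans e0.
  under eq_bigr do rewrite sumrN.
  by rewrite sumrN ReN oppr_le0; exact: k1.
(* The points to the left of tau remain to the left of tau - h. *)
have small a : \forall h \near (0:R)^'+, t a < tau -> h <= tau - t a.
  have [ta|ta] := ltP (t a) tau; last by apply: nearW.
  by near=> h => _; near: h; apply: nbhs_right_le; rewrite subr_gt0.
near=> h.
have h0 : 0 < h by near: h; exact: nbhs_right_gt.
have hs : forall a, t a < tau -> h <= tau - t a by near: h; exact: filter_forall.
have hQ : complex.Re (\sum_a \sum_b q a b h) < e by near: h; exact: Qlt.
suff GQ : G (tau - h) - G tau = h * complex.Re (\sum_a \sum_b q a b h).
  by rewrite -lerBlDl GQ [e * h]mulrC ler_wpM2l// ltW.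
have ReZ z : h * complex.Re z = complex.Re (h%:C * z).
  by case: z => x y /=; rewrite mul0r subr0.
rewrite ReZ -ReB; congr complex.Re.
rewrite mulr_sumr -sumrB; apply: eq_bigr => a _.
rewrite mulr_sumr -sumrB; apply: eq_bigr => b _.
have hC : h%:C != 0 by rewrite fmorph_eq0 gt_eqF.
rewrite /q /u; case: ifPn => [/andP[ta tb]|].
  rewrite ta tb.
  have -> : m a b tau = tau by apply/min_idPr; rewrite le_min ta.
  have -> : m a b (tau - h) = tau - h.
    by apply/min_idPr; rewrite le_min; apply/andP; split; lra.
  have Sstep c : tau <= t c ->
      S (Num.max (t c - (tau - h)) 0) (xi c) = S h (S (t c - tau) (xi c)).
    move=> tc; rewrite -SD ?subr_ge0// ?(ltW h0)// max_l; last lra.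
    by congr (S _ _); ring.
  rewrite !Sstep// !max_l ?subr_ge0//.
  rewrite (bformZl (kb a b)) (bformZr (kb a b)).
  rewrite (bformBl _ _ _ (kb a b)) (bformBr _ _ _ (kb a b)).
  have -> : ((h^-1)%:C)^* = (h^-1)%:C by rewrite geC0_conj// ler0c invr_ge0 ltW.
  rewrite fmorphV; field.
  by [].
rewrite mulr0 => ab; apply/eqP; rewrite subr_eq0; apply/eqP.
have mm : Num.min (t a) (t b) <= tau - h.
  move: ab; rewrite negb_and -!ltNge => /orP[] ct; rewrite ge_min; have := hs _ ct => ?.
    by apply/orP; left; lra.
  by apply/orP; right; lra.
have -> : m a b (tau - h) = Num.min (t a) (t b) by exact/min_idPl.
have -> // : m a b tau = Num.min (t a) (t b) by apply/min_idPl; lra.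
Unshelve. all: by end_near. Qed.

End PositiveDefinite.

(** * Complete dissipativity under the norm bound *)

Section Dissipation.
Context {R : realType} {H : hilbertType R} {I : Type}.
Variable A : I -> bounded_operator H H.
Implicit Types (beta : H -> H -> R[i]).

Definition dissipations beta (K : seq I) : H -> H -> R[i] :=
  foldr (fun i => dissipation (A i)) beta K.

Lemma bounded_form_dissipation beta (P : bounded_operator H H) :
  bounded_form beta -> bounded_form (dissipation P beta).
Proof.
move=> h; split; rewrite /dissipation.
- by move=> u u' v; rewrite (linearD P) !(bformDl h); ring.
- by move=> u v v'; rewrite (linearD P) !(bformDr h); ring.
- by move=> a u v; rewrite (linearZZ P) !(bformZl h); ring.
- by move=> a u v; rewrite (linearZZ P) !(bformZr h); ring.
have [c c0 hc] := bform_bound h; have [p p0 hp] := operator_bound_ge0 P.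
exists (c * (p + p)) => [|u v]; first by rewrite !(mulr_ge0, addr_ge0).
rewrite normrN; apply: le_trans (ler_normD _ _) _.
rewrite -mulrA mulrDl mulrDr; apply: lerD; apply: le_trans (hc _ _) _; rewrite ler_wpM2l//.
  by rewrite mulrA ler_wpM2r.
by rewrite mulrCA ler_wpM2l.
Qed.

Lemma bounded_form_dissipations beta K :
  bounded_form beta -> bounded_form (dissipations beta K).
Proof. by move=> h; elim: K => //= i K; exact: bounded_form_dissipation. Qed.

Lemma dissipations_comp beta (P Q : H -> H) K :
    (forall i u, A i (P u) = P (A i u)) -> (forall i u, A i (Q u) = Q (A i u)) ->
  dissipations (fun u v => beta (P u) (Q v)) K = fun u v => dissipations beta K (P u) (Q v).
Proof.
move=> AP AQ; elim: K => //= i K ->.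
by apply/funext => u; apply/funext => v; rewrite /dissipation AP AQ.
Qed.

(** With C_i u = omega_i^-1 A_i u + u, one has D_i beta (u, v) = omega_i (2 beta (u, v)
    - beta (C_i u, v) - beta (u, C_i v)).  If beta is within w e of w <u, v>, its norm
    is at most w (1 + e), hence D_i beta is within 2 omega_i w (e + c (1 + e)) of
    2 omega_i w <u, v>, and e + c (1 + e) = (1 + e) (1 + c) - 1. *)
Lemma dissipations_near_inner (omega : I -> R) (c : R) :
    (forall i, 0 < omega i) -> 0 <= c ->
    (forall i u, `|A i u + (omega i)%:C *: u| <= (omega i * c)%:C * `|u|) ->
  forall K, exists2 w : R, 0 < w & forall u v,
    `|dissipations inner K u v - w%:C * inner u v|
      <= (w * ((1 + c) ^+ size K - 1))%:C * (`|u| * `|v|).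
Proof.
move=> omega0 c0 Ac; elim=> [|i K [w w0 IH]].
  by exists 1 => // u v; rewrite /= expr0 subrr mulr0 mul0r mul1r subrr normr0.
exists (2 * omega i * w) => [|u v]; first by rewrite !mulr_gt0.
rewrite /= -/(dissipations inner K); set beta := dissipations inner K in IH *.
have hb : bounded_form beta by exact/bounded_form_dissipations/bounded_form_inner.
set e := (1 + c) ^+ size K - 1 in IH *.
have e0 : 0 <= e by rewrite subr_ge0 exprn_ege1// lerDl.
have bb x y : `|beta x y| <= (w * (1 + e))%:C * (`|x| * `|y|).
  rewrite -(subrK (w%:C * inner x y) (beta x y)); apply: le_trans (ler_normD _ _) _.
  rewrite mulrDr mulr1 rmorphD /= mulrDl addrC lerD//.
  rewrite normrM ger0_norm ?ler0c ?(ltW w0)// ler_wpM2l ?ler0c ?(ltW w0)//.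
  exact: inner_CauchySchwarz.
have -> : dissipation (A i) beta u v - (2 * omega i * w)%:C * inner u v =
    (2 * omega i)%:C * (beta u v - w%:C * inner u v)
    - beta (A i u + (omega i)%:C *: u) v - beta u (A i v + (omega i)%:C *: v).
  rewrite /dissipation !(bformDl hb) !(bformDr hb) (bformZl hb) (bformZr hb).
  rewrite (_ : ((omega i)%:C)^* = (omega i)%:C); last by rewrite geC0_conj// ler0c ltW.
  by rewrite !rmorphM /= rmorph_nat; ring.
have Au : `|beta (A i u + (omega i)%:C *: u) v| <=
    (w * (1 + e) * (omega i * c))%:C * (`|u| * `|v|).
  apply: le_trans (bb _ _) _; rewrite [in leRHS]rmorphM -[leRHS]mulrA; apply: ler_wpM2l.
    by rewrite ler0c mulr_ge0 ?(ltW w0)// addr_ge0.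
  by rewrite mulrA ler_wpM2r.
have Av : `|beta u (A i v + (omega i)%:C *: v)| <=
    (w * (1 + e) * (omega i * c))%:C * (`|u| * `|v|).
  apply: le_trans (bb _ _) _; rewrite [in leRHS]rmorphM -[leRHS]mulrA; apply: ler_wpM2l.
    by rewrite ler0c mulr_ge0 ?(ltW w0)// addr_ge0.
  by rewrite mulrCA ler_wpM2l.
have B : `|(2 * omega i)%:C * (beta u v - w%:C * inner u v)| <=
    (2 * omega i * (w * e))%:C * (`|u| * `|v|).
  rewrite normrM ger0_norm ?ler0c ?mulr_ge0 ?(ltW (omega0 i))//.
  rewrite [in leRHS]rmorphM -[leRHS]mulrA.
  by rewrite ler_wpM2l// ler0c mulr_ge0 ?(ltW (omega0 i)).
apply: le_trans (ler_normB _ _) _.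
apply: le_trans (lerD (le_trans (ler_normB _ _) (lerD B Au)) Av) _.
rewrite -!mulrDl -!rmorphD /= exprS -/(dissipations _).
have -> : (1 + c) ^+ size K = e + 1 by rewrite subrK.
by apply: ler_wpM2r; rewrite ?mulr_ge0// lecR le_eqVlt; apply/orP; left; apply/eqP; ring.
Qed.

Lemma dissipations_ge0 (omega : I -> R) (c : R) K :
    (forall i, 0 < omega i) -> 0 <= c ->
    (forall i u, `|A i u + (omega i)%:C *: u| <= (omega i * c)%:C * `|u|) ->
    (1 + c) ^+ size K <= 2 ->
  forall u, 0 <= complex.Re (dissipations inner K u u).
Proof.
move=> omega0 c0 Ac c2 u.
have [w w0 wP] := dissipations_near_inner omega0 c0 Ac K.
have := wP u u; rewrite -expr2 => /(le_trans (normc_ge_Re _)).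
have -> : inner u u = (complex.Re `|u|)%:C ^+ 2.
  by rewrite RRe_real ?normr_real// sqr_normE.
have -> : `|u| = (complex.Re `|u|)%:C by rewrite RRe_real ?normr_real.
rewrite -!rmorphXn -!rmorphM /= lecR ReB /= => /ler_normlP[+ _].
set n := _ ^+ 2; have n0 : 0 <= n by rewrite exprn_ge0// -ler0c RRe_real ?normr_real.
have : w * ((1 + c) ^+ size K - 1) * n <= w * n.
  by rewrite -mulrA ler_pM2l// -[leRHS]mul1r ler_wpM2r// lerBlDr.
lra.
Qed.

End Dissipation.

(** The supremum in the operator norm is over a bounded set only if f is bounded, so
    some bound c has to be known beforehand. *)
Lemma opnormP (R : realType) (H K : hilbertType R) (f : H -> K) (c : R) :
    (forall a u, f (a *: u) = a *: f u) -> (forall u, `|f u| <= c%:C * `|u|) ->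
  forall u, `|f u| <= (opnorm f)%:C * `|u|.
Proof.
move=> fZ fc u.
have nR (L : hilbertType R) (x : L) : `|x| = (complex.Re `|x|)%:C.
  by rewrite RRe_real ?normr_real.
have [->|u0] := eqVneq u 0.
  by rewrite -(scale0r (0 : H)) fZ !scale0r !normr0 mulr0.
have n0 : 0 < `|u| by rewrite normr_gt0.
rewrite -ler_pdivrMr// mulrC -[`|u|]ger0_norm ?normr_ge0// -normfV -normrZ -fZ.
rewrite [leLHS]nR lecR /opnorm; apply: ub_le_sup.
  exists `|c| => _ [x /= x1 <-].
  rewrite -lecR -nR; apply: le_trans (fc x) _.
  apply: (@le_trans _ _ (`|c|%:C * `|x|)); first by rewrite ler_wpM2r// lecR ler_norm.
  by rewrite -[leRHS]mulr1 ler_wpM2l// ler0c.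
exists (`|u|^-1 *: u) => //=.
by rewrite normrZ normfV normr_id mulVf// gt_eqF.
Qed.

(** For a kernel whose entries are all the same form, positive definiteness is the
    nonnegativity of this form on the sum of the vectors. *)
Lemma dissipations_inner_positive_definite (R : realType) (H : hilbertType R) (I J : finType)
    (A : J -> bounded_operator H H) (K : seq J) :
  (forall u, 0 <= complex.Re (dissipations A inner K u u)) ->
  positive_definite (fun _ _ : I => dissipations A inner K).
Proof.
move=> h xi; have := h (\sum_a xi a).
have hb : bounded_form (dissipations A inner K).
  exact/bounded_form_dissipations/bounded_form_inner.
rewrite (bform_suml _ _ hb); apply: eq_ind; congr (0 <= complex.Re _).
by apply: eq_bigr => a _; rewrite (bform_sumr _ _ hb).
Qed.

(** * Multi-parameter semigroups with bounded generators *)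

Section Orthant.
Context {R : realType} {d : nat}.
Implicit Types (s t : 'rV[R]_d).

Lemma orthant_scale (x : R) (i : 'I_d) : 0 <= x -> orthant (x *: (delta_mx 0 i : 'rV[R]_d)).
Proof. by move=> x0 j; rewrite !mxE eqxx /= mulr_ge0. Qed.

Lemma orthantD s t : orthant s -> orthant t -> orthant (s + t).
Proof. by move=> hs ht i; rewrite mxE addr_ge0. Qed.

Lemma orthant0 : orthant (0 : 'rV[R]_d).
Proof. by move=> i; rewrite mxE. Qed.

Lemma orthant_pos_part t : orthant (pos_part t).
Proof. by move=> i; rewrite mxE le_max lexx orbT. Qed.

(** The positive part of t with the coordinates outside L set to 0, when L has no
    repetition: the state of the induction over coordinates. *)
Definition partial_pos_part (L : seq 'I_d) t : 'rV[R]_d :=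
  \sum_(i <- L) Num.max (t 0 i) 0 *: delta_mx 0 i.

Lemma orthant_partial_pos_part L t : orthant (partial_pos_part L t).
Proof.
rewrite /partial_pos_part; elim: L => [|i L IH]; first by rewrite big_nil; exact: orthant0.
by rewrite big_cons; apply: orthantD => //; apply: orthant_scale; rewrite le_max lexx orbT.
Qed.

Lemma partial_pos_partT t : partial_pos_part (index_enum 'I_d) t = pos_part t.
Proof. by rewrite [RHS]row_sum_delta; apply: eq_bigr => i _; rewrite mxE. Qed.

Lemma neg_partE t : neg_part t = pos_part (- t).
Proof. by apply/rowP => i; rewrite !mxE. Qed.

Lemma pos_part_continuous : continuous (@pos_part R d).
Proof.
rewrite (_ : @pos_part R d = fun t => partial_pos_part (index_enum 'I_d) t); last first.
  by apply/funext => t; rewrite partial_pos_partT.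
apply: continuous_big => [|i _ t]; first exact: add_continuous.
apply: (@continuousZr_tmp R 'rV[R]_d 'rV[R]_d (fun t => Num.max (t 0 i) 0)).
apply: (@continuous_max R 'rV[R]_d (fun t => t 0 i) (cst 0)); last exact: cst_continuous.
exact: coord_continuous.
Qed.

End Orthant.

Section Semigroup.
Context {R : realType} {d : nat} {H : hilbertType R}.
Variable T : 'rV[R]_d -> bounded_operator H H.
Hypothesis T_semigroup : C0_semigroup T.
Variable A : 'I_d -> bounded_operator H H.
Hypothesis T_generators : forall i : 'I_d, has_bounded_generator (marginal T i) (A i).

Lemma semigroup_comp_continuous (X : topologicalType) (f : X -> 'rV[R]_d) :
    continuous f -> (forall x, orthant (f x)) ->
  forall u, continuous (fun x => T (f x) u).
Proof.
move=> fc fo u x.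
have /subspace_continuousP/(_ _ (fo x)) := @semigroup_continuous _ _ _ _ T_semigroup u.
apply: (@cvg_comp _ _ _ f (fun t => T t u) _ (within orthant (nbhs (f x)))) => P hP.
apply: (@filterS X (nbhs x) _ _ _ _ (fc x _ hP)) => y yP.
exact: (yP (fo y)).
Qed.

Lemma marginal0 i u : marginal T i 0 u = u.
Proof. by rewrite /marginal scale0r; exact: semigroup0. Qed.

Lemma marginalD i s t u : 0 <= s -> 0 <= t ->
  marginal T i (s + t) u = marginal T i s (marginal T i t u).
Proof.
by move=> s0 t0; rewrite /marginal scalerDl; apply: semigroupD => //; exact: orthant_scale.
Qed.

Lemma marginal_continuous i u : continuous (fun t : R => marginal T i (Num.max t 0) u).
Proof.
apply: semigroup_comp_continuous => x; last by apply: orthant_scale; rewrite le_max lexx orbT.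
apply: (@continuousZr_tmp R 'rV[R]_d R (fun t => Num.max t 0)).
by apply: (@continuous_max R R id (cst 0)); [exact: cvg_id|exact: cst_continuous].
Qed.

Lemma marginal_derivative i u :
  (h^-1)%:C *: (marginal T i h u - u) @[h --> 0^'+] --> A i u.
Proof.
have : generator (marginal T i) (u, A i u) by rewrite T_generators; exists u.
by [].
Qed.

(** Marginals commute with T(s), and T(s) is continuous, so it can be exchanged with
    the limit that defines the generator. *)
Lemma generator_comm i s u : orthant s -> A i (T s u) = T s (A i u).
Proof.
move=> os.
apply: (@cvg_unique _ (@norm_hausdorff _ H) _ _ _ _ (@marginal_derivative i (T s u))).
have Tc : continuous (T s) by exact/bounded_linear_continuous/operator_bounded.
have := cvg_comp _ _ (@marginal_derivative i u) (@Tc (A i u)).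
apply: cvg_trans; apply: near_eq_cvg; near=> h.
have h0 : 0 <= h by near: h; exact: nbhs_right_ge.
rewrite /= linearZZ linearB; congr (_ *: (_ - _)).
rewrite /marginal -[LHS]/((T s \o T _) u) -[RHS]/((T _ \o T s) u).
by rewrite -!semigroupD 1?addrC//; exact: orthant_scale.
Unshelve. all: by end_near. Qed.

(** Induction over the coordinates.  Inserting the i-th marginal into kappa commutes
    with the dissipations in the other directions, so the hypothesis for i :: L
    provides at each stage both kernels required by [positive_definite_propagate]:
    K and i :: K, for K a sublist of L. *)
Lemma positive_definite_regular (I : finType) (t : I -> 'rV[R]_d) (L : seq 'I_d)
    (kappa : I -> I -> H -> H -> R[i]) :
    (forall a b, bounded_form (kappa a b)) ->
    (forall K, subseq K L -> positive_definite (fun a b => dissipations A (kappa a b) K)) ->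
  positive_definite (fun a b u v => kappa a b
    (T (partial_pos_part L (t a - t b)) u) (T (partial_pos_part L (t b - t a)) v)).
Proof.
elim: L kappa => [|i L IH] kappa kb kpos.
  move=> xi; have := kpos [::] isT xi; apply: eq_ind; congr (0 <= complex.Re _).
  apply: eq_bigr => a _; apply: eq_bigr => b _.
  by rewrite /partial_pos_part !big_nil !(semigroup0 T_semigroup).
pose S := marginal T i.
pose kappa' a b u v := kappa a b (S (Num.max (t a 0 i - t b 0 i) 0) u)
  (S (Num.max (t b 0 i - t a 0 i) 0) v).
have max0 (x : R) : 0 <= Num.max x 0 by rewrite le_max lexx orbT.
have kb' a b : bounded_form (kappa' a b) by exact: bounded_form_comp.
have kpos' K : subseq K L -> positive_definite (fun a b => dissipations A (kappa' a b) K).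
  move=> KL.
  have := @positive_definite_propagate R H I (fun x => S x) (A i) (marginal0 i)
    (@marginalD i) (@marginal_continuous i) (@marginal_derivative i) (linear0 _)
    (fun a b => dissipations A (kappa a b) K) (fun a => t a 0 i)
    (fun a b => bounded_form_dissipations A K (kb a b)).
  move=> /(_ (kpos K (subseq_trans KL (subseq_cons L i)))) /(_ (kpos (i :: K) _)).
  rewrite /= eqxx => /(_ KL) h xi; have := h xi; apply: eq_ind; congr (0 <= complex.Re _).
  apply: eq_bigr => a _; apply: eq_bigr => b _; rewrite /kappa'.
  by rewrite (@dissipations_comp _ _ _ _ (kappa a b)
       (S (Num.max (t a 0 i - t b 0 i) 0)) (S (Num.max (t b 0 i - t a 0 i) 0)))//;
    move=> j u; apply: generator_comm; exact: orthant_scale.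
move=> xi; have := IH kappa' kb' kpos' xi; apply: eq_ind; congr (0 <= complex.Re _).
apply: eq_bigr => a _; apply: eq_bigr => b _; rewrite /kappa' /partial_pos_part !big_cons.
have step (x : R) w u : 0 <= x -> orthant w -> T (x *: delta_mx 0 i + w) u = S x (T w u).
  by move=> x0 ow; apply: semigroupD => //; exact: orthant_scale.
by rewrite !step//; try exact: orthant_partial_pos_part; rewrite !mxE.
Qed.

End Semigroup.

Section RegularDilation.
Context {R : realType} {d : nat} {H : hilbertType R}.
Variable T : 'rV[R]_d -> bounded_operator H H.
Hypothesis T_semigroup : C0_semigroup T.

(** The scalar identities provided by [naimark_dilation] are those of the weak form
    of the dilation, and the adjoints are recovered from them. *)
Theorem regular_dilation_of_positive_definite :
  (forall (I : finType) (t : I -> 'rV[R]_d), positive_definite (fun a b u v =>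
    inner (T (pos_part (t a - t b)) u) (T (pos_part (t b - t a)) v))) ->
  exists (K : hilbertType R) (U : 'rV[R]_d -> bounded_operator K K)
    (r : bounded_operator H K), regular_unitary_dilation T U r.
Proof.
move=> Tpd.
pose phi t u v := inner (T (pos_part t) u) (T (neg_part t) v).
have T0 u : T (pos_part 0) u = u.
  have -> : pos_part 0 = 0 :> 'rV[R]_d by apply/rowP => i; rewrite !mxE maxxx.
  exact: semigroup0.
have [|||||w|K [U [r [Urep Uphi]]]] := @naimark_dilation R d H phi.
- by move=> t u u' v; rewrite /phi linearD innerDl.
- by move=> t a u v; rewrite /phi linearZZ innerZl.
- by move=> t u v; rewrite /phi !neg_partE opprK innerC.
- by move=> u v; rewrite /phi neg_partE oppr0 !T0.
- move=> u v t; apply: (@bform_cvg R H inner _ (nbhs t) (fun s => T (pos_part s) u)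
      (fun s => T (neg_part s) v) _ _ _ bounded_form_inner).
    by apply: (semigroup_comp_continuous T_semigroup); 
      [exact: pos_part_continuous|exact: orthant_pos_part].
  rewrite (_ : @neg_part R d = (@pos_part R d) \o -%R); last first.
    by apply/funext => s; rewrite neg_partE.
  apply: (semigroup_comp_continuous T_semigroup) => s; last exact: orthant_pos_part.
  apply: (@continuous_comp 'rV[R]_d 'rV[R]_d 'rV[R]_d -%R (@pos_part R d)).
    exact: opp_continuous.
  exact: pos_part_continuous.
- have := Tpd 'I_(size w) (fun a => (tnth (in_tuple w) a).1)
    (fun a => (tnth (in_tuple w) a).2).
  apply: eq_ind; congr (0 <= complex.Re _); rewrite [LHS]big_tnth.
  apply: eq_bigr => a _; rewrite [LHS]big_tnth; apply: eq_bigr => b _.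
  by rewrite /phi neg_partE opprB.
exists K, U, r; split=> // t u; apply: inner_ext => x /=.
by rewrite -!adjointP [LHS]innerC [RHS]innerC Uphi.
Qed.

End RegularDilation.

Unset Implicit Arguments.
Set Strict Implicit.

Theorem theorem1p3 (R : realType) (d : nat) (d_gt0 : (0 < d)%N)
    (H : hilbertType R)
    (T : 'rV[R]_d -> bounded_operator H H) (T_semigroup : C0_semigroup T)
    (A : 'I_d -> bounded_operator H H)
    (T_generators : forall i : 'I_d, has_bounded_generator (marginal T i) (A i))
    (omega : 'rV[R]_d) (omega_gt0 : forall i : 'I_d, 0 < omega 0 i)
    (A_small : forall i : 'I_d,
      opnorm (A i \+ (omega 0 i)%:C \*: @idfun H) / omega 0 i
        <= 2 `^ (d%:R^-1) - 1) :
  exists (K : hilbertType R) (U : 'rV[R]_d -> bounded_operator K K)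
         (r : bounded_operator H K),
    regular_unitary_dilation T U r.
Proof.
set c := 2 `^ (d%:R^-1) - 1 in A_small.
have c1 : 1 + c = 2 `^ (d%:R^-1) by rewrite addrC subrK.
have dR : d%:R != 0 :> R by rewrite pnatr_eq0 -lt0n.
have c0 : 0 <= c.
  rewrite subr_ge0 -[leLHS](powRr0 2); apply: ler_powR; first by rewrite ler1n.
  by rewrite invr_ge0 ler0n.
have c2 : (1 + c) ^+ d = 2.
  by rewrite c1 -powR_mulrn ?powR_ge0// -powRrM mulVf// powRr1.
have Ac i u : `|A i u + (omega 0 i)%:C *: u| <= (omega 0 i * c)%:C * `|u|.
  have [b b0 hb] := operator_bound_ge0 (A i).
  have br : b = (complex.Re b)%:C by rewrite RRe_real// ger0_real.
  have hs : forall a v, (A i \+ (omega 0 i)%:C \*: @idfun H) (a *: v) =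
      a *: (A i \+ (omega 0 i)%:C \*: @idfun H) v.
    by move=> a v /=; rewrite linearZZ scalerDr !scalerA [a * _]mulrC.
  have hB v : `|(A i \+ (omega 0 i)%:C \*: @idfun H) v|
      <= (complex.Re b + omega 0 i)%:C * `|v|.
    rewrite rmorphD /= mulrDl -br; apply: le_trans (ler_normD _ _) _; apply: lerD => //.
    by rewrite normrZ ger0_norm// ler0c ltW.
  apply: le_trans (opnormP hs hB u) _; rewrite ler_wpM2r// lecR mulrC.
  by rewrite -ler_pdivrMr.
apply: regular_dilation_of_positive_definite => // I t.
have := @positive_definite_regular R d H T T_semigroup A T_generators I t (index_enum 'I_d)
  (fun _ _ => inner) (fun _ _ => bounded_form_inner).
move=> /(_ _) h xi.
have {}h := h _ xi.
move: h; under eq_bigr do under eq_bigr do rewrite !partial_pos_partT.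
apply=> K KL; apply: dissipations_inner_positive_definite.
apply: (@dissipations_ge0 _ _ _ A (fun i => omega 0 i) c) => //.
rewrite -c2; apply: ler_weXn2l; first by rewrite lerDl.
by have := size_subseq KL; rewrite [index_enum _]unlock -enumT size_enum_ord.
Qed.
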